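(* Let $0<\alpha<1$, let $P=\langle a,t,b,p,q\rangle$ be a parameter set, and let $y\in AC([a,b])$. If the kernel $k_{1-\alpha}$ is integrable and there exist functions $f$ and $g$ such that $$\int_a^t k_{1-\alpha}(\theta,\tau)\, d\theta+\int_a^\tau k_{1-\alpha}(t,\theta)\, d\theta = g(t)+f(\tau)$$ for all $t,\tau\in[a,b]$, then $$A_P^\alpha y(t)=p\,y(a)\,k_{1-\alpha}(t,a)-q\,y(b)\,k_{1-\alpha}(b,t)+B_P^\alpha y(t)$$ for all $t\in[a,b]$.
   Context: $[a,b]$ is a compact real interval and $AC([a,b])$ is the space of absolutely continuous functions on $[a,b]$. A parameter set ($p$-set) is $P=\langle a,t,b,p,q\rangle$ with $t\in[a,b]$ (the running variable) and $p,q$ real numbers. For a kernel $k_{\gamma}(\cdot,\cdot)$ on $[a,b]\times[a,b]$ (which may depend on the order $\gamma$), the generalized fractional integral of order $\gamma$ and $p$-set $P$ is $$K_P^{\gamma}f(t)=p\int_a^t k_{\gamma}(t,\tau)f(\tau)\,d\tau+q\int_t^b k_{\gamma}(\tau,t)f(\tau)\,d\tau .$$ With $D=\frac{d}{dt}$ the standard derivative and $\alpha\in(0,1)$, the generalized Riemann--Liouville fractional derivative is $A_P^\alpha=D\circ K_P^{1-\alpha}$ and the generalized Caputo fractional derivative is $B_P^\alpha=K_P^{1-\alpha}\circ D$, both formed with the kernel $k_{1-\alpha}$.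
   Formalization: The formula is proved for almost every t in [a,b], not for all t (pointwise it fails: changing the kernel on a null line alters only the right side); existence of the integrals in the kernel condition is made explicit, and a < b is assumed. *)

(* Defs.v *)
From HB Require Import structures.
From mathcomp Require Import all_boot all_order all_algebra.
From mathcomp Require Import all_classical all_reals all_analysis.

Set Implicit Arguments.
Unset Strict Implicit.
Unset Printing Implicit Defensive.

Import Order.TTheory GRing.Theory Num.Theory.
Import numFieldNormedType.Exports.

Local Open Scope classical_set_scope.
Local Open Scope ring_scope.

(* <a, t, b, p, q>; the running variable t is not stored, it is the argument
   of the functions produced by the operators below. *)
Record param_set (R : realType) := ParamSet { pa : R; pb : R; pp : R; pq : R }.

(* y \in AC([a, b]); only the values of y on [a, b] matter. *)
Definition absolutely_continuous_on (R : realType) (a b : R) (y : R -> R) :=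
  forall e : R, 0 < e -> exists2 d : R, 0 < d &
    forall (n : nat) (u v : 'I_n -> R),
      (forall i, [/\ a <= u i, u i < v i & v i <= b]) ->
      trivIset setT (fun i => `]u i, v i[%classic) ->
      \sum_(i < n) (v i - u i) < d ->
      \sum_(i < n) `|y (v i) - y (u i)| < e.

Definition kernel_integrable (R : realType) (a b : R) (h : R -> R -> R) :=
  ((@lebesgue_measure R) \x (@lebesgue_measure R))%E.-integrable
    (`[a, b] `*` `[a, b]) (fun z => (h z.1 z.2)%:E).

(* K_P^gam f (t); the family k is indexed by the order: k gam is the kernel
   of order gam. *)
Definition gfi (R : realType) (k : R -> R -> R -> R) (P : param_set R) (gam : R)
    (f : R -> R) (t : R) : R :=
  pp P * \int[lebesgue_measure]_(tau in `[pa P, t]) (k gam t tau * f tau)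
  + pq P * \int[lebesgue_measure]_(tau in `[t, pb P]) (k gam tau t * f tau).

(* The integral used above is total; this says that the two Lebesgue
   integrals defining K_P^gam f (t) really exist. *)
Definition gfi_defined (R : realType) (k : R -> R -> R -> R) (P : param_set R)
    (gam : R) (f : R -> R) (t : R) : Prop :=
  lebesgue_measure.-integrable `[pa P, t] (fun tau => (k gam t tau * f tau)%:E)
  /\
  lebesgue_measure.-integrable `[t, pb P] (fun tau => (k gam tau t * f tau)%:E).

Definition gRL (R : realType) (k : R -> R -> R -> R) (P : param_set R) (alpha : R)
    (y : R -> R) : R -> R :=
  derive1 (gfi k P (1 - alpha) y).

Definition gCaputo (R : realType) (k : R -> R -> R -> R) (P : param_set R)
    (alpha : R) (y : R -> R) : R -> R :=
  gfi k P (1 - alpha) (derive1 y).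

(* Existence of A_P^alpha y at t. *)
Definition gRL_defined (R : realType) (k : R -> R -> R -> R) (P : param_set R)
    (alpha : R) (y : R -> R) (t : R) : Prop :=
  derivable (gfi k P (1 - alpha) y) t 1.

(* Existence of B_P^alpha y at t; y need only be differentiable almost
   everywhere, the integrals do not see the remaining points. *)
Definition gCaputo_defined (R : realType) (k : R -> R -> R -> R) (P : param_set R)
    (alpha : R) (y : R -> R) (t : R) : Prop :=
  {ae lebesgue_measure, forall tau, tau \in `]pa P, pb P[ -> derivable y tau 1}
  /\ gfi_defined k P (1 - alpha) (derive1 y) t.

(* Main.v *)
Require Import Defs.
From HB Require Import structures.
From mathcomp Require Import all_boot all_order all_algebra.
From mathcomp Require Import all_classical all_reals all_analysis.
From mathcomp Require Import measurable_realfun ring lra.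

Set Implicit Arguments.
Unset Strict Implicit.
Unset Printing Implicit Defensive.

Import Order.TTheory GRing.Theory Num.Theory.
Import numFieldNormedType.Exports.

Local Open Scope classical_set_scope.
Local Open Scope ring_scope.

(** The hypothesis on the kernel K = k (1 - alpha) forces K to be a difference
    kernel: formally, applying d/dt d/dtau to the identity gives
    dK/dt + dK/dtau = 0, so that K t tau = h (t - tau).  Everything else is the
    classical fact that a convolution with an absolutely continuous function
    can be differentiated by moving the derivative onto that function.

    Since K is only integrable, the first point is proved on primitives
    ([difference_kernel]).  An integrable h is read off the two sides t = a and
    tau = a of the square; the difference w between K and h (t - tau) then
    satisfies  int_a^t w(x,tau) dx = - int_a^tau w(t,y) dy  everywhere on the
    square.  Integrating this relation twice produces a function Z that
    vanishes on the sides t = a and tau = a and whose increment over a step d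
    of a diagonal is at most d times the increment of a fixed monotone
    function; so Z is constant along diagonals
    ([quadratic_increments_constant]), hence zero, and undoing the integrations
    gives w = 0 almost everywhere on every line t = const and on every line
    tau = const inside the square ([characteristics0]).

    For the second point, y is the primitive of an integrable function phi
    ([absolutely_continuous_density]): the total variation of y is absolutely
    continuous, so its Lebesgue-Stieltjes measure has a Radon-Nikodym density.
    Writing y = y(a) + int_a phi in the left integral, y = y(b) - int phi in the
    right one, and exchanging integrals over triangles, each of the two
    integrals of the fractional operator becomes the primitive of an integrable
    function ([convolution_left], [convolution_right]); the Lebesgue
    differentiation theorem computes its derivative almost everywhere.  The
    boundary values of y contribute the terms y(a) K(t,a) and y(b) K(b,t).

    Integrability is meant with respect to Borel sets, so the integral of
    K times y' requires y' to be Borel measurable, and not just almost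
    everywhere equal to phi ([measurable_derive1_itv]). *)

(** * Variation of absolutely continuous functions *)

(** Families of intervals that arise by refining other families are naturally
    indexed by dependent sums; this frees the definition from ordinals. *)
Lemma absolutely_continuous_finType (R : realType) (a b : R) (y : R -> R) (e : R) :
  absolutely_continuous_on a b y -> 0 < e ->
  exists2 d : R, 0 < d & forall (I : finType) (u v : I -> R),
    (forall i, [/\ a <= u i, u i < v i & v i <= b]) ->
    trivIset setT (fun i => `]u i, v i[%classic) ->
    \sum_i (v i - u i) < d -> \sum_i `|y (v i) - y (u i)| < e.
Proof.
move=> hy e0; have [d d0 hd] := hy e e0; exists d => // I u v uv tuv.
have E (F : I -> R) : \sum_i F i = \sum_(j < #|I|) F (enum_val j).
  exact: big_enum_val.
rewrite !E; apply: hd => [i|i j _ _ /= /tuv]; first exact: uv.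
by move/(_ Logic.I Logic.I); exact: enum_val_inj.
Qed.

Lemma absolutely_continuousB (R : realType) (a b : R) (y z : R -> R) :
  absolutely_continuous_on a b y -> absolutely_continuous_on a b z ->
  absolutely_continuous_on a b (fun x => y x - z x).
Proof.
move=> hy hz e e0; have e20 : 0 < e / 2 by rewrite divr_gt0.
have [d1 d10 h1] := hy _ e20; have [d2 d20 h2] := hz _ e20.
exists (Num.min d1 d2); first by rewrite lt_min d10.
move=> n u v uv tuv; rewrite lt_min => /andP[s1 s2].
rewrite [e]splitr; apply: le_lt_trans (ltrD (h1 _ _ _ uv tuv s1) (h2 _ _ _ uv tuv s2)).
rewrite -big_split/=; apply: ler_sum => i _.
rewrite (_ : _ - _ - _ = (y (v i) - y (u i)) - (z (v i) - z (u i))); last by ring.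
exact: ler_normB.
Qed.

Lemma absolutely_continuous_uniform (R : realType) (a b : R) (y : R -> R) (e : R) :
  absolutely_continuous_on a b y -> 0 < e ->
  exists2 d : R, 0 < d & forall x x', a <= x <= b -> a <= x' <= b ->
    `|x - x'| < d -> `|y x - y x'| < e.
Proof.
move=> hy e0; have [d d0 hd] := hy e e0; exists d => //.
have main x x' : a <= x -> x < x' -> x' <= b -> x' - x < d -> `|y x' - y x| < e.
  move=> ax xx' x'b xd; have := hd 1%N (fun=> x) (fun=> x').
  rewrite !big_ord1; apply=> //.
  by move=> i j _ _ _; rewrite (ord1 i) (ord1 j).
move=> x x' /andP[ax xb] /andP[ax' x'b]; have [xx'|xx'|<-] := ltgtP x x'.
- by rewrite distrC gtr0_norm ?subr_gt0// distrC; exact: main.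
- by rewrite gtr0_norm ?subr_gt0//; exact: main.
- by rewrite !subrr normr0.
Qed.

(** Composing with [clip a b] turns a function on [a, b] into a function on the
    line with the same modulus of continuity, on which the theorems about
    globally continuous functions apply. *)
Definition clip (R : realType) (a b x : R) := Num.min b (Num.max a x).

Lemma clip_itv (R : realType) (a b x : R) : a <= b -> a <= clip a b x <= b.
Proof. by move=> ab; rewrite /clip le_min ab le_max lexx/= ge_min lexx. Qed.

Lemma clip_id (R : realType) (a b x : R) : a <= x <= b -> clip a b x = x.
Proof. by move=> /andP[ax xb]; rewrite /clip (max_idPr ax) (min_idPr xb). Qed.

Lemma clip_le (R : realType) (a b x x' : R) : x <= x' -> clip a b x <= clip a b x'.
Proof.
by move=> xx'; rewrite /clip le_min !ge_min lexx/= ge_max !le_max lexx xx' !orbT.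
Qed.

Lemma clip_dist (R : realType) (a b x x' : R) :
  `|clip a b x - clip a b x'| <= `|x - x'|.
Proof.
wlog xx' : x x' / x <= x'.
  move=> H; have [/H//|/ltW/H] := leP x x'.
  by rewrite distrC [X in _ <= X -> _]distrC.
rewrite !ler0_norm ?subr_le0 ?clip_le// /clip.
have [xa|ax] := leP x a; have [x'a|ax'] := leP x' a; try lra.
- by have [] := leP b a; have [] := leP b x'; lra.
- by have [] := leP b x; have [] := leP b x'; lra.
Qed.

Lemma absolutely_continuous_clip (R : realType) (a b : R) (y : R -> R) :
  a <= b -> absolutely_continuous_on a b y -> continuous (fun x => y (clip a b x)).
Proof.
move=> ab hy x; apply/cvgrPdist_lt => e e0.
have [d d0 hd] := absolutely_continuous_uniform hy e0.
exists d => //= z xz; apply: hd; rewrite ?clip_itv//.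
exact: le_lt_trans (clip_dist _ _ _ _) xz.
Qed.

Lemma absolutely_continuous_within (R : realType) (a b : R) (y : R -> R) :
  a <= b -> absolutely_continuous_on a b y -> {within `[a, b], continuous y}.
Proof.
move=> ab hy.
apply: (@subspace_eq_continuous _ _ _ (fun x => y (clip a b x))).
  by move=> x; rewrite inE/= in_itv/= => xab; rewrite clip_id.
exact/continuous_subspaceT/absolutely_continuous_clip.
Qed.

(** Refining each interval of a small family by a partition yields a family with
    the same total length, indexed by pairs (interval, subinterval). *)
Lemma absolutely_continuous_variation (R : realType) (a b : R) (y : R -> R) (e : R) :
  absolutely_continuous_on a b y -> 0 < e ->
  exists2 d : R, 0 < d & forall (I : finType) (u v : I -> R) (s : I -> seq R),
    (forall i, [/\ a <= u i, u i < v i & v i <= b]) ->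
    trivIset setT (fun i => `]u i, v i[%classic) ->
    \sum_i (v i - u i) < d ->
    (forall i, itv_partition (u i) (v i) (s i)) ->
    \sum_i variation (u i) (v i) y (s i) < e.
Proof.
move=> hy e0.
have [d d0 hd] := absolutely_continuous_finType hy e0.
exists d => // I u v s uv tuv suv hs.
pose T := {i : I & 'I_(size (s i))}.
pose x (i : I) (j : nat) := nth (v i) (u i :: s i) j.
have -> : \sum_i variation (u i) (v i) y (s i) =
  \sum_(p : T) `|y (x (tag p) (tagged p).+1) - y (x (tag p) (tagged p))|.
  rewrite /T -(@sig_big_dep _ _ _ _ _ xpredT (fun=> xpredT)
    (fun i (j : 'I_(size (s i))) => `|y (x i j.+1) - y (x i j)|))/=.
  by apply: eq_bigr => i _; rewrite /variation big_mkord.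
have xS i (j : 'I_(size (s i))) : x i j < x i j.+1.
  have [+ _] := hs i; move=> /(pathP (v i)) /(_ j (ltn_ord j)).
  exact.
have xge i j : (j < (size (s i)).+1)%N -> u i <= x i j.
  by move=> js; apply: itv_partition_nth_ge (hs i).
have xle i j : (j < (size (s i)).+1)%N -> x i j <= v i.
  by move=> js; apply: itv_partition_nth_le (hs i).
have xge0 i (j : 'I_(size (s i))) : u i <= x i j by rewrite xge// ltnS ltnW.
have xle0 i (j : 'I_(size (s i))) : x i j.+1 <= v i by rewrite xle// ltnS.
have xmono i j k : (j <= k)%N -> (k < (size (s i)).+1)%N -> x i j <= x i k.
  elim: k => [|k IH]; first by rewrite leqn0 => /eqP->.
  rewrite leq_eqVlt => /predU1P[->//|jk ks].
  rewrite (le_trans (IH _ _))//; first exact: ltnW ks.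
  by rewrite ltW// (xS i (Ordinal (ks : (k < size (s i))%N))).
apply: hd.
- move=> [i j] /=; have [ai ab ib] := uv i; split.
  + exact: le_trans ai _.
  + exact: xS.
  + exact: le_trans _ ib.
- move=> [i j] [i' j'] _ _ /= [z] /= [].
  rewrite /= !in_itv/= => /andP[z1 z2] /andP[z3 z4].
  (* Subintervals of different members cannot meet, as these are disjoint. *)
  have ii' : i = i'.
    apply: (tuv i i') => //; exists z; split; rewrite /= in_itv/=.
      by rewrite (le_lt_trans (xge0 i j) z1) (lt_le_trans z2 (xle0 i j)).
    by rewrite (le_lt_trans (xge0 i' j') z3) (lt_le_trans z4 (xle0 i' j')).
  subst i'; congr existT; apply: val_inj => /=.
  apply/eqP; rewrite eqn_leq; apply/andP; split; rewrite leqNgt; apply/negP => jj.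
    have := lt_trans z1 z4; rewrite ltNge => /negP; apply.
    by apply: xmono => //; rewrite ltnW// ltnS.
  have := lt_trans z3 z2; rewrite ltNge => /negP; apply.
  by apply: xmono => //; rewrite ltnW// ltnS.
- rewrite -(@sig_big_dep _ _ _ _ _ xpredT (fun=> xpredT)
    (fun i (j : 'I_(size (s i))) => x i j.+1 - x i j))/=.
  rewrite (le_lt_trans _ suv)//; apply: ler_sum => i _.
  rewrite -(big_mkord xpredT (fun j => x i j.+1 - x i j)) telescope_sumr//.
  by rewrite lerB// ?xle// xge.
Qed.

(** Intervals shorter than the modulus for 1 have variation at most 1, and
    finitely many of them cover [a, b]. *)
Lemma absolutely_continuous_BV (R : realType) (a b : R) (y : R -> R) :
  absolutely_continuous_on a b y -> bounded_variation a b y.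
Proof.
move=> hy; have [d d0 hd] := absolutely_continuous_variation hy ltr01.
have short c c' : a <= c -> c < c' -> c' <= b -> c' - c < d ->
    bounded_variation c c' y.
  move=> ac cc' c'b cd; exists 1 => _ [s hs <-]; apply: ltW.
  have := hd unit (fun=> c) (fun=> c') (fun=> s).
  rewrite !big_const !card_unit/= !addr0; apply => //.
  by move=> [] [].
(* Induction on the number of steps of length d / 2 from a to c. *)
have main n c : a < c -> c <= b -> c - a < (d / 2) *+ n -> bounded_variation a c y.
  elim: n c => [c ac _|n IH c ac cb can]; first by rewrite mulr0n ltNge subr_ge0 ltW.
  have [cd|dc] := ltP (c - a) d; first exact: short.
  pose c0 := c - d / 2.
  have ac0 : a < c0 by rewrite /c0; lra.
  have c0c : c0 < c by rewrite /c0; lra.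
  have H1 : bounded_variation a c0 y.
    apply: IH => //; first by rewrite /c0; lra.
    by move: can; rewrite mulrSr /c0; lra.
  have H2 : bounded_variation c0 c y.
    by apply: short => //; rewrite /c0; lra.
  apply/bounded_variationP; first exact: ltW.
  rewrite (@total_variationD _ a c c0)//; [|exact: ltW..].
  by rewrite fin_numD; apply/andP; split; apply/bounded_variationP => //; exact: ltW.
have [ab|ba|<-] := ltgtP a b; last exact: bounded_variationxx.
  have [n hn] : exists n : nat, b - a < (d / 2) *+ n.
    exists (Num.Def.archi_bound ((b - a) / (d / 2))).
    have d20 : 0 < d / 2 by lra.
    rewrite -mulr_natl -ltr_pdivrMr//; apply: archi_boundP.
    by rewrite divr_ge0 ?ltW ?subr_gt0.
  exact: (main n).
by exists 0 => z [s hs]; move: (itv_partition_le hs); rewrite leNgt ba.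
Qed.

(** The total variation inherits absolute continuity: the bound holds for every
    choice of partitions of the intervals of the family, hence for the suprema. *)
Lemma TV_family_le (R : realType) (a b : R) (y : R -> R) (e : R) :
  absolutely_continuous_on a b y -> 0 < e ->
  exists2 d : R, 0 < d & forall (I : finType) (u v : I -> R),
    (forall i, [/\ a <= u i, u i < v i & v i <= b]) ->
    trivIset setT (fun i => `]u i, v i[%classic) ->
    \sum_i (v i - u i) < d ->
    (\sum_i total_variation (u i) (v i) y <= e%:E)%E.
Proof.
move=> hy e0.
have [d d0 hd] := absolutely_continuous_variation hy e0.
exists d => // I u v uv tuv suv.
have etaP (eta : R) : 0 < eta ->
    (\sum_i total_variation (u i) (v i) y <= (e + #|I|%:R * eta)%:E)%E.
  move=> eta0.
  have TVfin i : total_variation (u i) (v i) y \is a fin_num.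
    have [ai ab ib] := uv i.
    apply/bounded_variationP; first exact: ltW.
    apply: (bounded_variationl (ltW ab) ib); apply: (bounded_variationr ai _ (absolutely_continuous_BV hy)).
    by rewrite (le_trans (ltW ab)).
  have ex i : exists s, itv_partition (u i) (v i) s /\
      (total_variation (u i) (v i) y - eta%:E < (variation (u i) (v i) y s)%:E)%E.
    have /(_ _ eta0) := @ub_ereal_sup_adherent R [set x%:E | x in variations (u i) (v i) y].
    by move=> /(_ (TVfin i))[_ [_ [s hs <-] <-]] hlt; exists s.
  have /choice[s hs] := ex.
  apply: (@le_trans _ _ (\sum_i (variation (u i) (v i) y (s i) + eta)%:E)%E).
    apply: lee_sum => i _; have [_ /ltW] := hs i.
    by rewrite leeBlDr// EFinD.
  rewrite sumEFin lee_fin big_split/= sumr_const -[eta *+ _]mulr_natl lerD// ltW//.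
  by apply: hd => // i; have [] := hs i.
apply/lee_addgt0Pr => eta eta0.
have n0 : 0 < (#|I|.+1%:R : R) by rewrite ltr0n.
apply: (le_trans (etaP (eta / #|I|.+1%:R) _)); first by rewrite divr_gt0.
rewrite -EFinD lee_fin lerD2l mulrCA ger_pMr// ler_pdivrMr// mul1r ler_nat.
exact: leqnSn.
Qed.

(** * Densities of absolutely continuous functions *)

Section density.
Variable R : realType.
Notation mu := (@lebesgue_measure R).

Lemma lebesgue_stieltjes_measure_oc (F : cumulative R R) (s t : R) : s <= t ->
  lebesgue_stieltjes_measure F `]s, t]%classic = (F t - F s)%:E.
Proof.
move=> st; rewrite /lebesgue_stieltjes_measure /measure_extension.
by rewrite measurable_mu_extE/= ?wlength_itv_bnd//; exact: is_ocitv.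
Qed.

Lemma lebesgue_measure_oc (s t : R) : s <= t -> mu `]s, t]%classic = (t - s)%:E.
Proof. by move=> st; rewrite /lebesgue_measure lebesgue_stieltjes_measure_oc. Qed.

Lemma lebesgue_measure_cover (N : set R) (d : R) : measurable N -> mu N = 0%E ->
  0 < d -> exists A : nat -> set R, [/\ forall n, ocitv (A n), N `<=` \bigcup_n A n &
    (\sum_(n <oo) mu (A n) < d%:E)%E].
Proof.
move=> mN N0 d0.
have /ereal_inf_lt[z [/= A [mA NA] Az zd]] : (mu N < d%:E)%E by rewrite N0 lte_fin.
exists A; split => //; apply: le_lt_trans zd; rewrite -Az.
rewrite (@eq_eseriesr _ (fun n => mu (A n)) (fun n => wlength idfun (A n)))//.
move=> n _; rewrite /= /lebesgue_measure/= /lebesgue_stieltjes_measure.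
by rewrite /measure_extension/= measurable_mu_extE//; exact: mA.
Qed.

(** Covers given by outer measures may overlap, whereas absolute continuity speaks
    of disjoint intervals; finite unions of half-open intervals can be
    rewritten as disjoint ones. *)
Lemma ocitv_disjoint_union (A : nat -> set R) (D : set R) (n : nat) :
  (forall i, ocitv (A i)) -> ocitv D ->
  exists (m : nat) (u v : 'I_m -> R), [/\ forall i, u i < v i,
    trivIset setT (fun i => `]u i, v i]%classic) &
    (\bigcup_(i < n) A i) `&` D = \big[setU/set0]_i `]u i, v i]%classic].
Proof.
move=> mA mD.
pose T := SetRing.type (ocitv_type R).
have mB : measurable ((\bigcup_(i < n) A i) `&` D : set T).
  apply: measurableI; last exact: sub_setring.
  by apply: fin_bigcup_measurable; [exact: finite_II|move=> i _; apply: sub_setring; exact: mA].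
have [B [fB B0 tB mB' eB]] := SetRing.ring_finite_set mB.
have ocB X : B X -> exists x : R * R, x.1 < x.2 /\ X = `]x.1, x.2]%classic.
  move=> BX; have := mB' X; rewrite inE => /(_ BX) /ocitvP[X0|[x x12 ->]].
    by have [z] := B0 _ BX; rewrite X0.
  by exists x.
have [s0 sB] := (finite_seqP B).1 fB.
pose s := undup s0; have us : uniq s by exact: undup_uniq.
have Bs X : B X <-> X \in s by rewrite sB mem_undup.
have /choice[x hx] : forall i : 'I_(size s), exists x : R * R,
    x.1 < x.2 /\ nth set0 s i = `]x.1, x.2]%classic.
  by move=> i; apply: ocB; apply/Bs; rewrite mem_nth.
exists (size s), (fun i => (x i).1), (fun i => (x i).2); split.
- by move=> i; have [] := hx i.
- move=> i j _ _; rewrite -(hx i).2 -(hx j).2 => ij.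
  apply/val_inj/eqP; rewrite -(nth_uniq set0 (ltn_ord i) (ltn_ord j) us); apply/eqP.
  by apply: tB ij; apply/Bs; rewrite mem_nth.
- rewrite eB; have -> : B = [set` s] by apply/seteqP; split => X /Bs.
  rewrite bigcup_seq (big_nth set0) big_mkord.
  by apply: eq_bigr => i _; rewrite -(hx i).2.
Qed.

(** A null set has covers of arbitrarily small total length.  Every finite part of
    such a cover, made disjoint, is a small family, so its Stieltjes measure is
    small, and continuity from below passes to the whole cover. *)
Lemma absolutely_continuous_null (a b : R) (F : cumulative R R) (N : set R) :
  a < b -> absolutely_continuous_on a b F -> measurable N -> mu N = 0%E ->
  lebesgue_stieltjes_measure F (N `&` `]a, b]) = 0%E.
Proof.
move=> ab acF mN N0.
set nu := lebesgue_stieltjes_measure F.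
apply/eqP; rewrite eq_le measure_ge0 andbT.
apply/lee_addgt0Pr => e e0; rewrite add0e.
have [d d0 hd] := absolutely_continuous_finType acF e0.
have [A [mA NA Ad]] := lebesgue_measure_cover mN N0 d0.
have mA' n : measurable (A n) by apply: sub_sigma_algebra; exact: mA.
pose B n := (\bigcup_(i < n) A i) `&` `]a, b]%classic.
have mB n : measurable (B n).
  by apply: measurableI => //; exact: bigcup_measurable.
have muB n : (mu (B n) < d%:E)%E.
  apply: le_lt_trans Ad; apply: measure_sigma_subadditive => //.
    exact: mB.
  by move=> x [[i _ Aix] _]; exists i.
have nuB n : (nu (B n) <= e%:E)%E.
  have ocD : ocitv `]a, b]%classic by exact: is_ocitv.
  have [m [u [v [uv tuv eB]]]] := ocitv_disjoint_union n mA ocD.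
  (* The definition of absolute continuity requires the endpoints in [a, b]. *)
  have uvab i : a <= u i /\ v i <= b.
    have sub : `]u i, v i]%classic `<=` `]a, b]%classic.
      move=> z zi; have : B n z by rewrite /B eB (bigD1 i)//=; left.
      by case.
    split.
      rewrite leNgt; apply/negP => uia.
      have /sub : `]u i, v i]%classic (Num.min a (v i)).
        by rewrite /= in_itv/= lt_min uia uv ge_min lexx orbT.
      by rewrite /= in_itv/= lt_min ltxx.
    have /sub : `]u i, v i]%classic (v i) by rewrite /= in_itv/= uv lexx.
    by rewrite /= in_itv/= => /andP[].
  (* Used both for F and, with G the identity, for Lebesgue measure. *)
  have sumE (G : cumulative R R) :
      lebesgue_stieltjes_measure G (B n) = (\sum_i (G (v i) - G (u i)))%:E.
    rewrite /B eB measure_bigsetU_ord//.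
    rewrite -sumEFin; apply: eq_bigr => i _.
    exact/lebesgue_stieltjes_measure_oc/ltW.
  rewrite /nu sumE lee_fin (le_trans (ler_norm _))// (le_trans (ler_norm_sum _ _ _))//.
  apply/ltW/hd.
  - by move=> i; have [] := uvab i.
  - move=> i j _ _ [z [zi zj]]; apply: tuv => //; exists z; split; exact: subset_itv_oo_oc.
  - rewrite -lte_fin -(sumE idfun); exact: muB.
have mBU : measurable (\bigcup_n B n) by exact: bigcup_measurable.
have cvgB : nu (B n) @[n --> \oo] --> nu (\bigcup_n B n).
  apply: nondecreasing_cvg_mu; [exact: mB|exact: mBU|].
  move=> m n mn; apply/subsetPset; apply: setSI; apply: bigcup_sub => i im.
  by apply: bigcup_sup; exact: leq_trans mn.
apply: (@le_trans _ _ (nu (\bigcup_n B n))).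
  apply: le_measure; [by rewrite inE; exact: measurableI mN (measurable_itv _)
    |by rewrite inE; exact: mBU|].
  by move=> x [/NA[n _ An] xab]; exists n.+1 => //; split => //; exists n => /=.
rewrite -(cvg_lim _ cvgB)//; apply: lime_le; first by apply/cvg_ex; eexists; exact: cvgB.
exact: nearW.
Qed.

(** By the previous lemma the Stieltjes measure of v, restricted to ]a, b], is
    dominated by Lebesgue measure; the density is its Radon-Nikodym derivative. *)
Lemma nondecreasing_absolutely_continuous_density (a b : R) (v : R -> R) :
  a < b -> {in `[a, b] &, {homo v : x y / x <= y}} -> absolutely_continuous_on a b v ->
  exists2 phi : R -> R, mu.-integrable setT (EFin \o phi) &
    forall x, a <= x <= b -> v x = v a + \int[mu]_(t in `[a, x]) phi t.
Proof.
move=> ab vnd acv.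
pose V x := v (clip a b x).
have Vid x : a <= x <= b -> V x = v x by move=> xab; rewrite /V clip_id.
have Vnd : {homo V : x y / x <= y}.
  move=> x y xy; apply: vnd; last exact: clip_le.
    by rewrite in_itv/= clip_itv// ltW.
  by rewrite in_itv/= clip_itv// ltW.
have Vc : continuous V by apply: absolutely_continuous_clip => //; exact: ltW.
have Vrc : right_continuous V by apply: right_continuousW.
pose F : cumulative R R := HB.pack V (isCumulative.Build R _ R V Vnd Vrc).
have acF : absolutely_continuous_on a b F.
  move=> e e0; have [d d0 hd] := acv e e0; exists d => // n u w uw tuw duw.
  rewrite (eq_bigr (fun i => `|v (w i) - v (u i)|)); first exact: hd.
  move=> i _; have [au uwi wb] := uw i.
  rewrite -[F (w i)]/(V (w i)) -[F (u i)]/(V (u i)) !Vid//.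
    by rewrite au (le_trans (ltW uwi)).
  by rewrite wb (le_trans au (ltW uwi)).
pose nu := lebesgue_stieltjes_measure F.
pose D := `]a, b]%classic.
have mD : measurable (D : set (measurableTypeR R)) by exact: measurable_itv.
have nuD : (nu D < +oo)%E by rewrite /nu lebesgue_stieltjes_measure_oc ?ltW// ltry.
have dom : mfrestr mD nuD `<< mu.
  apply/null_content_dominatesP => N mN N0.
  exact: absolutely_continuous_null ab acF mN N0.
have [f [f0 ffin fi fE]] := radon_nikodym_sigma_finite dom.
have iphi : mu.-integrable setT (EFin \o (fine \o f)).
  rewrite (_ : EFin \o _ = f)//; apply/funext => x /=; exact: fineK.
exists (fine \o f) => //.
move=> x /andP[ax xb].
have sub : `]a, x]%classic `<=` D by exact: subset_itvl.
have : nu `]a, x]%classic = (\int[mu]_(t in `]a, x]%classic) f t)%E.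
  transitivity (mfrestr mD nuD `]a, x]%classic); first by rewrite /mfrestr /mrestr setIidl.
  exact: fE (measurable_itv _).
rewrite /nu lebesgue_stieltjes_measure_oc// -[F x]/(V x) -[F a]/(V a) !Vid ?lexx ?(ltW ab) ?ax//.
move=> E; rewrite /Rintegral -integral_itv_obnd_cbnd//.
  under eq_integral do rewrite /= fineK//.
  by rewrite -E /= addrC subrK.
apply: (measurable_int mu); exact: (integrableS measurableT _ _ iphi).
Qed.

(** Both the variation tv of y and tv - y are nondecreasing and absolutely
    continuous, so y is a difference of two primitives. *)
Theorem absolutely_continuous_density (a b : R) (y : R -> R) :
  a < b -> absolutely_continuous_on a b y ->
  exists2 phi : R -> R, mu.-integrable setT (EFin \o phi) &
    forall x, a <= x <= b -> y x = y a + \int[mu]_(t in `[a, x]) phi t.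
Proof.
move=> ab acy.
pose tv x := fine (total_variation a x y).
have BVy := absolutely_continuous_BV acy.
have tvfin s t : a <= s -> s <= t -> t <= b -> total_variation s t y \is a fin_num.
  move=> as_ st tb; apply/bounded_variationP => //.
  by apply: (bounded_variationl st tb); apply: (bounded_variationr as_ _ BVy); exact: le_trans tb.
have tvB s t : a <= s -> s <= t -> t <= b -> tv t - tv s = fine (total_variation s t y).
  move=> as_ st tb; rewrite /tv (total_variationD _ as_ st) fineD ?tvfin//.
    by rewrite addrC addKr.
  exact: le_trans tb.
have tvge s t : a <= s -> s <= t -> t <= b -> `|y t - y s| <= tv t - tv s.
  move=> as_ st tb; rewrite tvB// -lee_fin fineK ?tvfin//.
  exact: total_variation_ge.
have actv : absolutely_continuous_on a b tv.
  move=> e e0; have e20 : 0 < e / 2 by rewrite divr_gt0.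
  have [d d0 hd] := TV_family_le acy e20; exists d => // n u v uv tuv suv.
  apply: le_lt_trans (_ : e / 2 < e); last by lra.
  rewrite -lee_fin; apply: le_trans (hd _ u v uv tuv suv).
  rewrite -sumEFin; apply: lee_sum => i _; have [au uvi vb] := uv i.
  rewrite (tvB _ _ au (ltW uvi) vb) ger0_norm ?fineK ?tvfin//; first exact: ltW.
  by rewrite fine_ge0// total_variation_ge0// ltW.
have [p1 ip1 e1] : exists2 phi : R -> R, mu.-integrable setT (EFin \o phi) &
    forall x, a <= x <= b -> tv x = tv a + \int[mu]_(t in `[a, x]) phi t.
  apply: nondecreasing_absolutely_continuous_density ab _ actv => s t.
  rewrite !in_itv/= => /andP[as_ _] /andP[_ tb] st.
  by rewrite -subr_ge0 (le_trans _ (tvge _ _ as_ st tb)).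
have [p2 ip2 e2] : exists2 phi : R -> R, mu.-integrable setT (EFin \o phi) &
    forall x, a <= x <= b -> tv x - y x = tv a - y a + \int[mu]_(t in `[a, x]) phi t.
  apply: nondecreasing_absolutely_continuous_density ab _ _; last first.
    exact: absolutely_continuousB.
  move=> s t; rewrite !in_itv/= => /andP[as_ _] /andP[_ tb] st.
  have := le_trans (ler_norm _) (tvge _ _ as_ st tb); lra.
exists (fun t => p1 t - p2 t).
  rewrite (_ : _ \o _ = (EFin \o p1) \- (EFin \o p2))%E//.
  exact: integrableB.
move=> x xab; rewrite RintegralB//.
- by have := e1 x xab; have := e2 x xab; lra.
- by apply: integrableS ip1.
- by apply: integrableS ip2.
Qed.

End density.

(** * Translations and reflections of Lebesgue measure *)

Section lebesgue_isometry.
Variable R : realType.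
Notation mu := (@lebesgue_measure R).

Section preserving.
Variable s : {mfun measurableTypeR R >-> measurableTypeR R}.
Hypothesis s_mu : forall A : set (measurableTypeR R), measurable A -> mu (s @^-1` A) = mu A.

Let push (f : R -> \bar R) (D : set (measurableTypeR R)) :
  (\int[pushforward mu s]_(x in D) f x = \int[mu]_(x in D) f x)%E.
Proof. by apply: eq_measure_integral => A mA _; exact: s_mu. Qed.

Let ms : measurable_fun setT s := @measurable_funPT _ _ _ _ s.

Lemma integrable_preserving (f : R -> R) :
  mu.-integrable setT (EFin \o f) -> mu.-integrable setT (EFin \o (f \o s)).
Proof.
move=> /integrableP[mf If]; apply/integrableP; split.
  exact: (measurableT_comp mf ms).
apply: le_lt_trans If.
rewrite -(push (fun x => `|(EFin \o f) x|%E)) ge0_integral_pushforward//.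
exact: measurableT_comp.
Qed.

Lemma Rintegral_preserving (f : R -> R) (D : set (measurableTypeR R)) : measurable D ->
  mu.-integrable setT (EFin \o f) ->
  \int[mu]_(x in s @^-1` D) f (s x) = \int[mu]_(x in D) f x.
Proof.
move=> mD If; rewrite /Rintegral -(push (EFin \o f)) integral_pushforward//.
- exact: measurable_int If.
- apply: (integrableS measurableT _ _ (integrable_preserving If)) => //.
  by rewrite -[_ @^-1` _]setTI; exact: ms.
Qed.

Lemma ge0_integral_preserving (f : R -> R) : measurable_fun setT f ->
  (forall x, 0 <= f x) ->
  (\int[mu]_x (f (s x))%:E = \int[mu]_x (f x)%:E)%E.
Proof.
move=> mf f0; rewrite -[RHS]push ge0_integral_pushforward//; first exact/measurable_EFinP.
by move=> x _; rewrite lee_fin.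
Qed.
End preserving.

Let msub (r : R) : measurable_fun (setT : set (measurableTypeR R))
  ((fun x : R => x - r) : measurableTypeR R -> measurableTypeR R).
Proof. exact: measurable_funB. Qed.

Let m_sub (r : R) : {mfun measurableTypeR R >-> measurableTypeR R} :=
  MeasurableFun.Pack (MeasurableFun.Class (isMeasurableFun.Build _ _ _ _ _ (msub r))).

Let mrev (r : R) : measurable_fun (setT : set (measurableTypeR R))
  ((fun x : R => r - x) : measurableTypeR R -> measurableTypeR R).
Proof. exact: measurable_funB. Qed.

Let m_rev (r : R) : {mfun measurableTypeR R >-> measurableTypeR R} :=
  MeasurableFun.Pack (MeasurableFun.Class (isMeasurableFun.Build _ _ _ _ _ (mrev r))).

Let mu_push (s : {mfun measurableTypeR R >-> measurableTypeR R}) :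
  (forall u v : R, u < v -> mu (s @^-1` `]u, v]%classic) = (v - u)%:E) ->
  forall A : set (measurableTypeR R), measurable A -> mu (s @^-1` A) = mu A.
Proof.
move=> H A mA; apply/esym.
apply: (@lebesgue_measure_unique R (pushforward mu s)) => // X /ocitvP[->|[[u v] /= uv ->]].
  by rewrite !measure0.
by rewrite lebesgue_measure_oc ?ltW//; rewrite -(H _ _ uv).
Qed.

Lemma lebesgue_measure_shift (r : R) (A : set (measurableTypeR R)) : measurable A ->
  mu ((fun x => x - r) @^-1` A) = mu A.
Proof.
apply: (mu_push (s := m_sub r)) => // u v uv.
rewrite (_ : _ @^-1` _ = `](u + r), (v + r)]%classic).
  by rewrite lebesgue_measure_oc ?lerD2r ?ltW//; congr EFin; ring.
by apply/seteqP; split => x /=; rewrite !in_itv/= ltrBrDr lerBlDr.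
Qed.

Lemma lebesgue_measure_rev (r : R) (A : set (measurableTypeR R)) : measurable A ->
  mu ((fun x => r - x) @^-1` A) = mu A.
Proof.
apply: (mu_push (s := m_rev r)) => // u v uv.
rewrite (_ : _ @^-1` _ = `[(r - v), (r - u)[%classic).
  rewrite lebesgue_measure_itv/= lte_fin ltrD2l ltrN2 uv -EFinD; congr EFin; ring.
by apply/seteqP; split => x /=; rewrite !in_itv/= ltrBrDr -ltrBrDl lerBlDr -lerBlDl andbC.
Qed.

Lemma integrable_shift (h : R -> R) (r : R) :
  mu.-integrable setT (EFin \o h) -> mu.-integrable setT (EFin \o (fun x => h (x - r))).
Proof. exact: (integrable_preserving (s := m_sub r) (@lebesgue_measure_shift r)). Qed.

Lemma integrable_rev (h : R -> R) (r : R) :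
  mu.-integrable setT (EFin \o h) -> mu.-integrable setT (EFin \o (fun x => h (r - x))).
Proof. exact: (integrable_preserving (s := m_rev r) (@lebesgue_measure_rev r)). Qed.

Lemma Rintegral_shift (h : R -> R) (r c d : R) : mu.-integrable setT (EFin \o h) ->
  \int[mu]_(x in `[c, d]) h (x - r) = \int[mu]_(x in `[c - r, d - r]) h x.
Proof.
move=> ih; rewrite -[RHS](Rintegral_preserving (s := m_sub r) (@lebesgue_measure_shift r))//.
congr Rintegral; apply/seteqP.
by split => x /=; rewrite !in_itv/= !lerD2r.
Qed.

Lemma Rintegral_rev (h : R -> R) (r c d : R) : mu.-integrable setT (EFin \o h) ->
  \int[mu]_(x in `[c, d]) h (r - x) = \int[mu]_(x in `[r - d, r - c]) h x.
Proof.
move=> ih; rewrite -[RHS](Rintegral_preserving (s := m_rev r) (@lebesgue_measure_rev r))//.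
congr Rintegral; apply/seteqP.
by split => x /=; rewrite !in_itv/= !lerD2l !lerN2 andbC.
Qed.

Lemma ge0_integral_shift (f : R -> R) (r : R) : measurable_fun setT f ->
  (forall x, 0 <= f x) -> (\int[mu]_x (f (x - r))%:E = \int[mu]_x (f x)%:E)%E.
Proof. exact: (ge0_integral_preserving (s := m_sub r) (@lebesgue_measure_shift r)). Qed.

Lemma ge0_integral_rev (f : R -> R) (r : R) : measurable_fun setT f ->
  (forall x, 0 <= f x) -> (\int[mu]_x (f (r - x))%:E = \int[mu]_x (f x)%:E)%E.
Proof. exact: (ge0_integral_preserving (s := m_rev r) (@lebesgue_measure_rev r)). Qed.

End lebesgue_isometry.

(** * Iterated integrals of real functions *)

Section fubini_R.
Variable R : realType.
Notation mu := (@lebesgue_measure R).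
Notation T := (measurableTypeR R).
Notation mu2 := (mu \x mu)%E.

(** An integrable extended real function is finite almost everywhere, so passing
    to its real values changes nothing. *)
Lemma integrable_fine (g : T -> \bar R) : mu.-integrable setT g ->
  mu.-integrable setT (EFin \o (fine \o g)) /\ \int[mu]_x fine (g x) = fine (\int[mu]_x g x)%E.
Proof.
move=> ig.
have mg := measurable_int _ ig.
have mfg : measurable_fun setT (fine \o g) by exact: measurableT_comp.
have ifg : mu.-integrable setT (EFin \o (fine \o g)).
  apply: le_integrable ig => //; first exact/measurable_EFinP.
  by move=> x _ /=; case: (g x) => [r||] /=; rewrite ?lexx ?leey.
split=> //; rewrite /Rintegral; congr fine.
apply: ae_eq_integral => //; first exact/measurable_EFinP.
have := integrable_ae measurableT ig; apply: filterS => x /(_ I) gx _.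
by rewrite /= fineK.
Qed.

(** Companion of [integrable_fubini_F] for the other order of integration. *)
Lemma integrable_fubini_G (f : T * T -> \bar R) : mu2.-integrable setT f ->
  mu.-integrable setT (fubini_G mu f).
Proof.
move=> ifx; have mf := measurable_int _ ifx.
apply/integrableP; split; first exact: (measurable_fubini_G ifx).
apply: le_lt_trans ((integrable21ltyP _ _ mf).1 ifx).
apply: ge0_le_integral => //.
- by apply: measurableT_comp => //; exact: (measurable_fubini_G ifx).
- apply: (measurable_fun_fubini_tonelli_G (abse \o f)) => //=.
  exact: measurableT_comp.
- move=> y _; apply: le_abse_integral => //.
  exact: measurableT_comp.
Qed.

Lemma Rfubini (f : R -> R -> R) : mu2.-integrable setT (fun z => (f z.1 z.2)%:E) ->
  [/\ mu.-integrable setT (EFin \o (fun x => \int[mu]_y f x y)),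
      mu.-integrable setT (EFin \o (fun y => \int[mu]_x f x y)) &
      \int[mu]_x \int[mu]_y f x y = \int[mu]_y \int[mu]_x f x y].
Proof.
move=> ifx.
have [i1 e1] := integrable_fine (integrable_fubini_F ifx).
have [i2 e2] := integrable_fine (integrable_fubini_G ifx).
split; [exact: i1|exact: i2|].
apply: (etrans e1); apply: etrans (esym e2); congr fine.
exact: (etrans (integral12_prod_meas1 ifx) (esym (integral21_prod_meas1 ifx))).
Qed.

(** Fubini on a measurable region D of the plane, described once by its vertical
    sections A' x over A and once by its horizontal sections B' y over B.
    Rectangles and triangles are the instances used below. *)
Lemma Rfubini_region (f : R -> R -> R) (D : set (T * T)) (A B : set R) (A' B' : R -> set R) :
  measurable D -> mu2.-integrable D (fun z => (f z.1 z.2)%:E) ->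
  measurable (A : set T) -> measurable (B : set T) ->
  (forall x y, D (x, y) <-> A x /\ A' x y) ->
  (forall x y, D (x, y) <-> B y /\ B' y x) ->
  [/\ mu.-integrable A (EFin \o (fun x => \int[mu]_(y in A' x) f x y)),
      mu.-integrable B (EFin \o (fun y => \int[mu]_(x in B' y) f x y)) &
      \int[mu]_(x in A) \int[mu]_(y in A' x) f x y =
      \int[mu]_(y in B) \int[mu]_(x in B' y) f x y].
Proof.
move=> mD + mA mB DA DB; rewrite (integrable_mkcond _ mD) => ifD.
pose g x y := if pselect (D (x, y)) is left _ then f x y else 0.
have gE : (fun z : T * T => (f z.1 z.2)%:E) \_ D = (fun z => (g z.1 z.2)%:E).
  apply/funext => -[x y]; rewrite /patch /g /=; case: pselect => h.
    by rewrite mem_set.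
  by rewrite memNset.
rewrite gE in ifD.
have gA : (fun x => \int[mu]_y g x y) = (fun x => \int[mu]_(y in A' x) f x y) \_ A.
  apply/funext => x; rewrite /patch; case: ifPn => [/set_mem Ax|/negP Ax].
    rewrite [RHS]Rintegral_mkcond; apply: eq_Rintegral => y _.
    rewrite /g /patch; case: pselect => [/DA[_ h]|h]; first by rewrite mem_set.
    by rewrite memNset// => ?; apply: h; apply/DA.
  rewrite (_ : g x = fun=> 0) ?Rintegral_cst ?mul0r//; apply/funext => y; rewrite /g.
  by case: pselect => // /DA[?]; have := Ax; rewrite inE.
have gB : (fun y => \int[mu]_x g x y) = (fun y => \int[mu]_(x in B' y) f x y) \_ B.
  apply/funext => y; rewrite /patch; case: ifPn => [/set_mem By|/negP By].
    rewrite [RHS]Rintegral_mkcond; apply: eq_Rintegral => x _.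
    rewrite /g /patch; case: pselect => [/DB[_ h]|h]; first by rewrite mem_set.
    by rewrite memNset// => ?; apply: h; apply/DB.
  rewrite (_ : (fun x => g x y) = fun=> 0) ?Rintegral_cst ?mul0r//; apply/funext => x; rewrite /g.
  by case: pselect => // /DB[?]; have := By; rewrite inE.
have [] := Rfubini ifD.
rewrite gA gB -!restrict_EFin => i1 i2 e; split.
- by rewrite integrable_mkcond.
- by rewrite integrable_mkcond.
- by rewrite [LHS]Rintegral_mkcond [RHS]Rintegral_mkcond.
Qed.

(** Tonelli: a kernel G with uniformly integrable sections, times an integrable
    weight in the free variable, is integrable on the plane. *)
Lemma integrable_prod1 (G : R -> R -> R) (v : R -> R) (C : R) :
  measurable_fun setT (fun z : T * T => G z.1 z.2) ->
  (forall y, (\int[mu]_x `|G x y|%:E <= C%:E)%E) ->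
  mu.-integrable setT (EFin \o v) ->
  mu2.-integrable setT (fun z : T * T => (G z.1 z.2 * v z.2)%:E).
Proof.
move=> mG GC iv.
have /integrableP[/measurable_EFinP mv _] := iv.
have mGv : measurable_fun setT (fun z : T * T => (G z.1 z.2 * v z.2)%:E).
  by apply/measurable_EFinP; apply: measurable_funM => //; exact: measurableT_comp.
apply/integrable21ltyP => //.
have G1 y : measurable_fun setT (fun x : T => `|G x y|%:E).
  apply/measurable_EFinP; apply: measurableT_comp => //.
  exact: (measurableT_comp mG (pair2_measurable y)).
have C0 : 0 <= C.
  by rewrite -lee_fin (le_trans _ (GC 0))//; apply: integral_ge0 => x _; rewrite lee_fin.
apply: (@le_lt_trans _ _ (\int[mu]_y (C%:E * `|(v y)%:E|))%E).
  apply: ge0_le_integral => //.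
  - by move=> y _; exact: integral_ge0.
  - apply: (measurable_fun_fubini_tonelli_G (abse \o (fun z : T * T => (G z.1 z.2 * v z.2)%:E))) => //=.
    exact: measurableT_comp.
  - by apply: emeasurable_funM => //; apply: measurableT_comp => //; exact/measurable_EFinP.
  - move=> y _ /=.
    under eq_integral do rewrite /= normrM EFinM.
    rewrite ge0_integralZr//.
    by apply: lee_wpmul2r; rewrite ?lee_fin// GC.
rewrite ge0_integralZl//; last first.
  by apply: measurableT_comp => //; exact/measurable_EFinP.
rewrite lte_mul_pinfty//.
by have /integrableP[] := iv.
Qed.

Lemma integrable_prod2 (G : R -> R -> R) (v : R -> R) (C : R) :
  measurable_fun setT (fun z : T * T => G z.1 z.2) ->
  (forall x, (\int[mu]_y `|G x y|%:E <= C%:E)%E) ->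
  mu.-integrable setT (EFin \o v) ->
  mu2.-integrable setT (fun z : T * T => (G z.1 z.2 * v z.1)%:E).
Proof.
move=> mG GC iv.
have /integrableP[/measurable_EFinP mv _] := iv.
have mGv : measurable_fun setT (fun z : T * T => (G z.1 z.2 * v z.1)%:E).
  by apply/measurable_EFinP; apply: measurable_funM => //; exact: measurableT_comp.
apply/integrable12ltyP => //.
have G1 x : measurable_fun setT (fun y : T => `|G x y|%:E).
  apply/measurable_EFinP; apply: measurableT_comp => //.
  exact: (measurableT_comp mG (pair1_measurable x)).
have C0 : 0 <= C.
  by rewrite -lee_fin (le_trans _ (GC 0))//; apply: integral_ge0 => x _; rewrite lee_fin.
apply: (@le_lt_trans _ _ (\int[mu]_x (C%:E * `|(v x)%:E|))%E).
  apply: ge0_le_integral => //.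
  - by move=> x _; exact: integral_ge0.
  - apply: (measurable_fun_fubini_tonelli_F (abse \o (fun z : T * T => (G z.1 z.2 * v z.1)%:E))) => //=.
    exact: measurableT_comp.
  - by apply: emeasurable_funM => //; apply: measurableT_comp => //; exact/measurable_EFinP.
  - move=> x _ /=.
    under eq_integral do rewrite /= normrM EFinM.
    rewrite ge0_integralZr//.
    by apply: lee_wpmul2r; rewrite ?lee_fin// GC.
rewrite ge0_integralZl//; last first.
  by apply: measurableT_comp => //; exact/measurable_EFinP.
rewrite lte_mul_pinfty//.
by have /integrableP[] := iv.
Qed.

Lemma measurable_triangle (c d : R) :
  measurable [set z : T * T | (c <= z.2 <= z.1) && (z.1 <= d)].
Proof.
rewrite (_ : [set _ | _] = [set z : T * T | c <= z.2] `&` [set z : T * T | z.2 <= z.1] `&`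
  [set z : T * T | z.1 <= d]); last first.
  apply/seteqP; split => z /=; first by move=> /andP[/andP[]].
  by move=> [[-> ->] ->].
have m1 : measurable_fun setT (fun z : T * T => z.1 : T) by exact: measurable_fst.
have m2 : measurable_fun setT (fun z : T * T => z.2 : T) by exact: measurable_snd.
have mle (f g : T * T -> T) : measurable_fun setT f -> measurable_fun setT g ->
    measurable [set z : T * T | f z <= g z].
  move=> mf mg; rewrite -[X in measurable X]setTI.
  have := measurable_fun_ler mf mg.
  by move=> /(_ measurableT [set true] _); exact.
apply: measurableI; first apply: measurableI.
- exact: (mle (fun=> c)).
- exact: mle.
- exact: (mle _ (fun=> d)).
Qed.

Lemma Rfubini_triangle (f : R -> R -> R) (c d : R) :
  mu2.-integrable setT (fun z => (f z.1 z.2)%:E) ->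
  [/\ mu.-integrable `[c, d] (EFin \o (fun x => \int[mu]_(y in `[c, x]) f x y)),
      mu.-integrable `[c, d] (EFin \o (fun y => \int[mu]_(x in `[y, d]) f x y)) &
      \int[mu]_(x in `[c, d]) \int[mu]_(y in `[c, x]) f x y =
      \int[mu]_(y in `[c, d]) \int[mu]_(x in `[y, d]) f x y].
Proof.
move=> fi; apply: (@Rfubini_region f _ `[c, d]%classic `[c, d]%classic
  (fun x => `[c, x]%classic) (fun y => `[y, d]%classic) (measurable_triangle c d)) => //.
- by apply: integrableS fi => //; exact: measurable_triangle.
- move=> x y /=; rewrite !in_itv/=; split.
    move=> /andP[/andP[cy yx] xd]; rewrite cy yx xd andbT; split=> //.
    exact: le_trans yx.
  by move=> [/andP[_ ->] ->].
- move=> x y /=; rewrite !in_itv/=; split.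
    move=> /andP[/andP[cy yx] xd]; rewrite cy yx xd; split=> //.
    exact: le_trans xd.
  by move=> [/andP[-> _] ->].
Qed.

(** Integration by parts for two absolutely continuous functions given by their
    derivatives: both sides integrate u x * v y over the triangle y <= x. *)
Lemma Rintegral_by_parts (u v : R -> R) (c d : R) :
  mu.-integrable setT (EFin \o u) -> mu.-integrable setT (EFin \o v) ->
  [/\ mu.-integrable `[c, d] (EFin \o (fun x => u x * \int[mu]_(y in `[c, x]) v y)),
      mu.-integrable `[c, d] (EFin \o (fun x => v x * \int[mu]_(y in `[x, d]) u y)) &
      \int[mu]_(x in `[c, d]) (u x * \int[mu]_(y in `[c, x]) v y) =
      \int[mu]_(x in `[c, d]) (v x * \int[mu]_(y in `[x, d]) u y)].
Proof.
move=> iu iv.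
have /integrableP[/measurable_EFinP mu_ fu] := iu.
have ifuv : mu2.-integrable setT (fun z : T * T => (u z.1 * v z.2)%:E).
  apply: (@integrable_prod1 (fun x _ => u x) v (fine (\int[mu]_x `|u x|%:E)%E)) => //.
    exact: measurableT_comp.
  move=> y; rewrite fineK// ge0_fin_numE//; exact: integral_ge0.
have Z w r A : measurable (A : set T) -> mu.-integrable setT (EFin \o w) ->
    \int[mu]_(x in A) (r * w x) = r * \int[mu]_(x in A) w x.
  by move=> mA iw; rewrite RintegralZl//; exact: integrableS iw.
have E1 : (fun x => \int[mu]_(y in `[c, x]) (u x * v y)) =
    (fun x => u x * \int[mu]_(y in `[c, x]) v y).
  by apply/funext => x; rewrite Z.
have E2 : (fun y => \int[mu]_(x in `[y, d]) (u x * v y)) =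
    (fun y => v y * \int[mu]_(x in `[y, d]) u x).
  by apply/funext => y; under eq_Rintegral do rewrite mulrC; rewrite Z.
have := @Rfubini_triangle (fun x y => u x * v y) c d ifuv.
by rewrite E1 E2.
Qed.

(** Translations and reflections preserve the integral, so all sections of
    h (x - y) have the same absolute integral as h. *)
Lemma integrable_convolution_kernel (h v : R -> R) :
  mu.-integrable setT (EFin \o h) -> mu.-integrable setT (EFin \o v) ->
  mu2.-integrable setT (fun z : T * T => (h (z.1 - z.2) * v z.2)%:E) /\
  mu2.-integrable setT (fun z : T * T => (h (z.1 - z.2) * v z.1)%:E).
Proof.
move=> ih iv.
have /integrableP[/measurable_EFinP mh fh] := ih.
have mhd : measurable_fun setT (fun z : T * T => h (z.1 - z.2)).
  by apply: (measurableT_comp mh); apply: measurable_funB;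
    [exact: measurable_fst|exact: measurable_snd].
pose C := fine (\int[mu]_x `|h x|%:E)%E.
have CE : (\int[mu]_x `|h x|%:E = C%:E)%E.
  by rewrite fineK// ge0_fin_numE//; exact: integral_ge0.
have mnh : measurable_fun setT (fun x : T => `|h x|) by exact: measurableT_comp.
split.
- apply: (@integrable_prod1 (fun x y => h (x - y)) v C) => // y.
  by rewrite -CE (ge0_integral_shift (f := fun x => `|h x|)).
- apply: (@integrable_prod2 (fun x y => h (x - y)) v C) => // x.
  by rewrite -CE (ge0_integral_rev (f := fun x => `|h x|)).
Qed.

End fubini_R.

(** * Derivatives of convolutions *)

Section convolution.
Variable R : realType.
Notation mu := (@lebesgue_measure R).
Notation T := (measurableTypeR R).

Lemma Rintegral_itv_split (g : R -> R) (a c b : R) : a <= c -> c <= b ->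
  mu.-integrable `[a, b] (EFin \o g) ->
  \int[mu]_(x in `[a, b]) g x = \int[mu]_(x in `[a, c]) g x + \int[mu]_(x in `[c, b]) g x.
Proof.
move=> ac cb ig.
have := @Rintegral_itvB R g (BLeft a) (BRight b) c ig.
rewrite !bnd_simp => /(_ ac cb) h.
rewrite -(@Rintegral_itv_obnd_cbnd _ c (BRight b)) -?h; last first.
  apply: integrableS ig => //; apply: subset_itvr; rewrite bnd_simp//.
by rewrite addrC subrK.
Qed.

Lemma ae_derive_primitive (g : R -> R) (a : R) :
  mu.-integrable setT (EFin \o g) ->
  {ae mu, forall x : R, a < x -> is_derive x 1 (fun x => \int[mu]_(t in `[a, x]) g t) (g x)}.
Proof.
move=> ig.
have := @FTC1 R g (BLeft a).
have H1 y : mu.-integrable [set` Interval (BLeft a) (BRight y)] (EFin \o g).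
  exact: integrableS ig.
have H2 : locally_integrable [set: R] g by apply: open_integrable_locally => //; exact: openT.
move=> /(_ H1 H2); apply: filterS; first exact: (ae_filter_ringOfSetsType mu).
move=> x H ax; have [|d e] := H; first by rewrite /= lte_fin.
by rewrite derive1E in e; exact: DeriveDef d e.
Qed.

(** Derivatives at an interior point only see the function inside the interval. *)
Lemma near_itv_is_derive (F G : R -> R) (a b x l : R) : a < x < b ->
  (forall z, a < z < b -> F z = G z) -> is_derive x 1 F l -> is_derive x 1 G l.
Proof.
move=> xab FG; apply: near_eq_is_derive.
have := @near_in_itvoo R a b x; rewrite in_itv/= => /(_ xab); apply: filterS => z.
by rewrite in_itv/=; exact: FG.
Qed.

Lemma ae_derive_primitive_right (g : R -> R) (a b : R) :
  mu.-integrable setT (EFin \o g) ->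
  {ae mu, forall x : R, a < x < b ->
    is_derive x 1 (fun x => \int[mu]_(t in `[x, b]) g t) (- g x)}.
Proof.
move=> ig; have := ae_derive_primitive a ig.
apply: filterS; first exact: (ae_filter_ringOfSetsType mu).
move=> x H /andP[ax xb].
apply: (@near_itv_is_derive (fun z => \int[mu]_(t in `[a, b]) g t - \int[mu]_(t in `[a, z]) g t) _ a b).
- by rewrite ax xb.
- move=> z /andP[/ltW az /ltW zb]; rewrite (Rintegral_itv_split az zb); first by ring.
  exact: integrableS ig.
- rewrite -[- g x]add0r; exact: (is_deriveB (is_derive_cst _ _ _) (H ax)).
Qed.

(** The reflection of [r, t] about its midpoint exchanges t - x and x - r. *)
Lemma Rintegral_shift_rev (h : R -> R) (r t : R) : mu.-integrable setT (EFin \o h) ->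
  \int[mu]_(x in `[r, t]) h (t - x) = \int[mu]_(x in `[r, t]) h (x - r).
Proof. by move=> ih; rewrite Rintegral_rev// Rintegral_shift// !subrr. Qed.

Lemma RintegralZlT (w : R -> R) (r : R) (A : set R) : measurable (A : set T) ->
  mu.-integrable setT (EFin \o w) ->
  \int[mu]_(x in A) (r * w x) = r * \int[mu]_(x in A) w x.
Proof. by move=> mA iw; rewrite RintegralZl//; exact: integrableS iw. Qed.

Lemma integrableZT (w : R -> R) (r : R) (A : set R) : measurable (A : set T) ->
  mu.-integrable setT (EFin \o w) -> mu.-integrable A (EFin \o (fun x => w x * r)).
Proof.
move=> mA iw.
have /(@integrableZr _ _ _ _ _ mA r) : mu.-integrable A (EFin \o w) by exact: integrableS iw.
by apply: eq_integrable.
Qed.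

Section identities.
Variables (h phi y : R -> R) (a b : R).
Hypotheses (ih : mu.-integrable setT (EFin \o h)) (iphi : mu.-integrable setT (EFin \o phi)).
Hypothesis yE : forall x, a <= x <= b -> y x = y a + \int[mu]_(t in `[a, x]) phi t.

(** The integrals over [r, t] of h (t - s) ds and of h (x - r) dx agree
    ([Rintegral_shift_rev]); this is where a difference kernel is used.  It lets
    the inner variable of the triangle be replaced by the outer one, which turns
    the convolution into a primitive in t. *)
Lemma convolution_left (t : R) : a <= t <= b ->
  \int[mu]_(s in `[a, t]) (h (t - s) * y s) =
  y a * \int[mu]_(x in `[a, t]) h (x - a) +
  \int[mu]_(x in `[a, t]) \int[mu]_(r in `[a, x]) (h (x - r) * phi r).
Proof.
move=> /andP[at_ tb].
have iht := integrable_rev t ih.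
have [i1 _ e1] := Rintegral_by_parts a t iht iphi.
have [_ _ e2] := @Rfubini_triangle _ (fun x y => h (x - y) * phi y) a t
  (integrable_convolution_kernel ih iphi).1.
transitivity (\int[mu]_(s in `[a, t]) (h (t - s) * y a + h (t - s) * \int[mu]_(r in `[a, s]) phi r)).
  apply: eq_Rintegral => s; rewrite inE/= in_itv/= => /andP[as_ st].
  by rewrite yE ?as_ ?(le_trans st)// mulrDr.
rewrite RintegralD//; last by exact: (integrableZT (y a) _ iht).
congr (_ + _).
  under eq_Rintegral do rewrite mulrC.
  by rewrite RintegralZlT// Rintegral_shift_rev.
rewrite e1 e2; apply: eq_Rintegral => r _.
under [RHS]eq_Rintegral do rewrite mulrC.
by rewrite RintegralZlT ?Rintegral_shift_rev//; exact: integrable_shift.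
Qed.

(** Mirror image of [convolution_left], with y expressed from its value at b. *)
Lemma convolution_right (t : R) : a <= t <= b ->
  \int[mu]_(s in `[t, b]) (h (s - t) * y s) =
  y b * \int[mu]_(x in `[t, b]) h (b - x) -
  \int[mu]_(x in `[t, b]) \int[mu]_(r in `[x, b]) (h (r - x) * phi r).
Proof.
move=> /andP[at_ tb].
have iht := integrable_shift t ih.
have [_ i1 e1] := Rintegral_by_parts t b iphi iht.
have [_ _ e2] := @Rfubini_triangle _ (fun x y => h (x - y) * phi x) t b
  (integrable_convolution_kernel ih iphi).2.
transitivity (\int[mu]_(s in `[t, b]) (h (s - t) * y b - h (s - t) * \int[mu]_(r in `[s, b]) phi r)).
  apply: eq_Rintegral => s; rewrite inE/= in_itv/= => /andP[ts sb].
  have as_ : a <= s by exact: le_trans ts.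
  rewrite (yE (x := s)) ?as_// (yE (x := b)) ?lexx ?(le_trans as_)//.
  rewrite (Rintegral_itv_split as_ sb); first by ring.
  exact: integrableS iphi.
rewrite RintegralB//; last by exact: (integrableZT (y b) _ iht).
congr (_ - _).
  under eq_Rintegral do rewrite mulrC.
  by rewrite RintegralZlT// -Rintegral_shift_rev.
rewrite -e1 -e2; apply: eq_Rintegral => r _.
under [RHS]eq_Rintegral do rewrite mulrC.
rewrite RintegralZlT -?Rintegral_shift_rev//; exact: integrable_rev.
Qed.

Lemma convolution_left_derive :
  {ae mu, forall t : R, a < t < b ->
    mu.-integrable setT (EFin \o (fun r => h (t - r) * phi r)) /\
    is_derive t 1 (fun t => \int[mu]_(s in `[a, t]) (h (t - s) * y s))
      (y a * h (t - a) + \int[mu]_(s in `[a, t]) (h (t - s) * phi s))}.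
Proof.
have ik := (integrable_convolution_kernel ih iphi).1.
have [ic _ _] := @Rfubini_triangle _ (fun x y => h (x - y) * phi y) a b ik.
pose c x := \int[mu]_(r in `[a, x]) (h (x - r) * phi r).
have iT : mu.-integrable setT (EFin \o (c \_ `[a, b])).
  by rewrite -restrict_EFin -integrable_mkcond.
have d1 := ae_derive_primitive a (integrable_shift a ih).
have d2 := ae_derive_primitive a iT.
have d3 := ae_integrable1 ik.
move: d1 d2 d3; apply: filterS3; first exact: (ae_filter_ringOfSetsType mu).
move=> t D1 D2 D3 /andP[at_ tb]; split; first exact: D3.
apply: (@near_itv_is_derive (fun z => y a * \int[mu]_(x in `[a, z]) h (x - a) +
  \int[mu]_(x in `[a, z]) (c \_ `[a, b]) x) _ a b).
- by rewrite at_ tb.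
- move=> z /andP[/ltW az /ltW zb]; rewrite convolution_left ?az//; congr (_ + _); apply: eq_Rintegral => x.
  rewrite inE/= in_itv/= => /andP[ax xz]; rewrite patchE mem_set//=.
  by rewrite in_itv/= ax (le_trans xz).
- have := is_deriveD (is_deriveZ (y a) (D1 at_)) (D2 at_).
  by rewrite patchE mem_set//= in_itv/= !ltW.
Qed.

Lemma convolution_right_derive :
  {ae mu, forall t : R, a < t < b ->
    mu.-integrable setT (EFin \o (fun r => h (r - t) * phi r)) /\
    is_derive t 1 (fun t => \int[mu]_(s in `[t, b]) (h (s - t) * y s))
      (- (y b * h (b - t)) + \int[mu]_(s in `[t, b]) (h (s - t) * phi s))}.
Proof.
have ik := (integrable_convolution_kernel ih iphi).2.
have [_ ic _] := @Rfubini_triangle _ (fun x y => h (x - y) * phi x) a b ik.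
pose c x := \int[mu]_(r in `[x, b]) (h (r - x) * phi r).
have iT : mu.-integrable setT (EFin \o (c \_ `[a, b])).
  by rewrite -restrict_EFin -integrable_mkcond.
have d1 := ae_derive_primitive_right a b (integrable_rev b ih).
have d2 := ae_derive_primitive_right a b iT.
have d3 := ae_integrable2 ik.
move: d1 d2 d3; apply: filterS3; first exact: (ae_filter_ringOfSetsType mu).
move=> t D1 D2 D3 tab; split; first exact: D3.
have /andP[at_ tb] := tab.
apply: (@near_itv_is_derive (fun z => y b * \int[mu]_(x in `[z, b]) h (b - x) -
  \int[mu]_(x in `[z, b]) (c \_ `[a, b]) x) _ a b) => //.
- move=> z /andP[/ltW az /ltW zb]; rewrite convolution_right ?az//; congr (_ - _); apply: eq_Rintegral => x.
  rewrite inE/= in_itv/= => /andP[zx xb]; rewrite patchE mem_set//=.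
  by rewrite in_itv/= xb andbT (le_trans az).
- have := is_deriveB (is_deriveZ (y b) (D1 tab)) (D2 tab).
  by rewrite opprK scalerN patchE mem_set//= in_itv/= !ltW.
Qed.

End identities.

End convolution.

(** * Iterated primitives and constancy criteria *)

Section transport.
Variable R : realType.
Notation mu := (@lebesgue_measure R).
Notation T := (measurableTypeR R).

(** An integrable function is almost everywhere the derivative of its primitive. *)
Lemma primitive0_ae (g : R -> R) (a b : R) : mu.-integrable setT (EFin \o g) ->
  (forall x, a < x < b -> \int[mu]_(t in `[a, x]) g t = 0) ->
  {ae mu, forall x, a < x < b -> g x = 0}.
Proof.
move=> ig g0; have := ae_derive_primitive a ig.
apply: filterS; first exact: (ae_filter_ringOfSetsType mu).
move=> x H /andP[ax xb].
have D0 : is_derive x 1 (fun x => \int[mu]_(t in `[a, x]) g t) 0.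
  apply: (near_eq_is_derive _ (is_derive_cst 0 x 1)).
  have := @near_in_itvoo R a b x; rewrite in_itv/= ax xb => /(_ isT).
  by apply: filterS => z; rewrite in_itv/= => zab; rewrite g0.
have [_ e0] := D0; have [_ e1] := H ax.
by rewrite -e1 e0.
Qed.

(** The inner primitive is continuous, so it is everywhere the derivative of the
    outer one. *)
Lemma primitive_primitive0 (v : R -> R) (a b : R) : mu.-integrable setT (EFin \o v) ->
  (forall x, a < x < b -> \int[mu]_(t in `[a, x]) \int[mu]_(s in `[a, t]) v s = 0) ->
  forall x, a < x < b -> \int[mu]_(t in `[a, x]) v t = 0.
Proof.
move=> iv V0 x xab; have /andP[ax xb] := xab.
have ab : a < b by exact: lt_trans xb.
have ivab : mu.-integrable `[a, b] (EFin \o v) by exact: integrableS iv.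
have cV := parameterized_integral_continuous (ltW ab) ivab.
have iV : mu.-integrable `[a, b] (EFin \o (fun t => \int[mu]_(s in `[a, t]) v s)).
  by apply: continuous_compact_integrable => //; exact: segment_compact.
have cVx : {for x, continuous (fun t => \int[mu]_(s in `[a, t]) v s)}.
  have [+ _ _] := (continuous_within_itvP _ ab).1 cV.
  by apply; rewrite in_itv/= ax xb.
have [d e] := continuous_FTC1_closed xb iV ax cVx.
rewrite -e derive1E.
rewrite (@near_eq_derive _ _ _ _ (cst 0)) ?derive_cst//.
have := @near_in_itvoo R a b x; rewrite in_itv/= ax xb => /(_ isT).
by apply: filterS => z; rewrite in_itv/= => zab; rewrite V0.
Qed.

Lemma integrable_itv_cst (x y r : R) : mu.-integrable `[x, y] (EFin \o (fun=> r)).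
Proof.
apply: continuous_compact_integrable; first exact: segment_compact.
by apply: continuous_subspaceT => z; exact: cst_continuous.
Qed.

Lemma Rintegral_itv_cst (x y r : R) : x <= y -> \int[mu]_(z in `[x, y]) r = r * (y - x).
Proof.
move=> xy; transitivity (r * fine (mu `[x, y]%classic)); first exact: Rintegral_cst.
congr (_ * _); rewrite lebesgue_measure_itv/= lte_fin.
case: ltP => [//|yx]; have -> : x = y by apply/eqP; rewrite eq_le xy yx.
by rewrite /= subrr.
Qed.

(** Cauchy formula for a double primitive. *)
Lemma primitive_primitive (v : R -> R) (c d : R) : mu.-integrable setT (EFin \o v) ->
  mu.-integrable `[c, d] (EFin \o (fun x => \int[mu]_(y in `[c, x]) v y)) /\
  \int[mu]_(x in `[c, d]) \int[mu]_(y in `[c, x]) v y =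
  \int[mu]_(x in `[c, d]) (v x * (d - x)).
Proof.
move=> iv.
pose u : R -> R := (fun=> 1 : R) \_ `[c, d].
have iu : mu.-integrable setT (EFin \o u).
  rewrite /u -restrict_EFin -integrable_mkcond//; exact: integrable_itv_cst.
have u1 x : x \in `[c, d]%classic -> u x = 1 by move=> xcd; rewrite /u patchE xcd.
have [i1 _ e1] := Rintegral_by_parts c d iu iv; split.
  apply: eq_integrable i1 => // x xcd /=.
  by rewrite u1// mul1r.
transitivity (\int[mu]_(x in `[c, d]) (u x * \int[mu]_(y in `[c, x]) v y)).
  by apply: eq_Rintegral => x xcd; rewrite u1// mul1r.
rewrite e1; apply: eq_Rintegral => x; rewrite inE/= in_itv/= => /andP[cx xd].
congr (_ * _).
transitivity (\int[mu]_(y in `[x, d]) 1).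
  apply: eq_Rintegral => z; rewrite inE/= in_itv/= => /andP[xz zd].
  by apply: u1; rewrite inE/= in_itv/= zd (le_trans cx).
by rewrite Rintegral_itv_cst// mul1r.
Qed.

(** Halving [x, x'] halves the bound: the first factor is halved on each part
    while the increments of rho add up.  Iterating makes the increment of phi
    smaller than any positive number. *)
Lemma quadratic_increments_constant (phi rho : R -> R) (c d : R) : c <= d ->
  (forall x x', c <= x -> x <= x' -> x' <= d ->
    `|phi x' - phi x| <= (x' - x) * (rho x' - rho x)) -> phi d = phi c.
Proof.
move=> cd H.
have main n : forall x x', c <= x -> x <= x' -> x' <= d ->
    `|phi x' - phi x| <= (x' - x) * (rho x' - rho x) / 2 ^+ n.
  elim: n => [|n IH] x x' cx xx' x'd; first by rewrite expr0 divr1 H.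
  pose m := (x + x') / 2.
  have xm : x <= m by rewrite /m; lra.
  have mx' : m <= x' by rewrite /m; lra.
  have h1 := IH x m cx xm (le_trans mx' x'd).
  have h2 := IH m x' (le_trans cx xm) mx' x'd.
  rewrite (_ : phi x' - phi x = (phi x' - phi m) + (phi m - phi x)); last by ring.
  apply: (le_trans (ler_normD _ _)); apply: (le_trans (lerD h2 h1)).
  rewrite -mulrDl exprS invfM mulrA ler_pM2r ?invr_gt0 ?exprn_gt0//.
  rewrite (_ : x' - m = (x' - x) / 2); last by rewrite /m; field.
  rewrite (_ : m - x = (x' - x) / 2); last by rewrite /m; field.
  by rewrite le_eqVlt; apply/orP; left; apply/eqP; field.
apply/eqP; rewrite -subr_eq0 -normr_le0; apply/ler_addgt0Pr => e e0; rewrite add0r.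
pose A := (d - c) * (rho d - rho c).
have A0 : 0 <= A by rewrite (le_trans _ (H c d _ _ _)).
pose n := Num.Def.archi_bound (A / e).
have n1 : A / e < n%:R by apply: archi_boundP; rewrite divr_ge0// ltW.
apply: (le_trans (main n c d _ _ _)) => //.
rewrite ler_pdivrMr ?exprn_gt0// -/A mulrC -ler_pdivrMr// (le_trans (ltW n1))//.
by rewrite -natrX ler_nat ltnW// ltn_expl.
Qed.

(** No correspondence between the two intervals is needed, since the bound on
    p x - q y is uniform: p can be integrated against each fixed value of q, and
    then q be integrated. *)
Lemma pivot_bound (p q : R -> R) (t t' s s' c : R) : t <= t' -> t' - t = s' - s ->
  mu.-integrable `[s, s'] (EFin \o p) -> mu.-integrable `[t, t'] (EFin \o q) ->
  (forall x y, s <= x <= s' -> t <= y <= t' -> `|p x - q y| <= c) ->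
  `|\int[mu]_(x in `[s, s']) p x - \int[mu]_(y in `[t, t']) q y| <= (t' - t) * c.
Proof.
move=> tt' ee ip iq pq.
have cst x y (r : R) : x <= y -> mu.-integrable `[x, y] (EFin \o (fun=> r)) /\
    \int[mu]_(z in `[x, y]) r = r * (y - x).
  by move=> xy; split; [exact: integrable_itv_cst|exact: Rintegral_itv_cst].
have bound (f : R -> R) x y r : x <= y -> mu.-integrable `[x, y] (EFin \o f) ->
    (forall z, x <= z <= y -> `|f z| <= r) -> `|\int[mu]_(z in `[x, y]) f z| <= r * (y - x).
  move=> xy if_ fr; have [ir <-] := cst x y r xy.
  apply: (le_trans (le_normr_Rintegral _ if_)) => //.
  apply: le_Rintegral => //.
  by have := integrable_norm if_; apply: eq_integrable.
have ss' : s <= s' by rewrite -subr_ge0 -ee subr_ge0.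
have step y : t <= y <= t' -> `|\int[mu]_(x in `[s, s']) p x - q y * (s' - s)| <= c * (s' - s).
  move=> yt; have [iq1 <-] := cst s s' (q y) ss'.
  rewrite -RintegralB//; apply: bound => //.
    apply: eq_integrable (integrableB _ ip iq1) => //.
  by move=> z zs; exact: pq.
have [st|] := ltP s s'; last first.
  move=> s's; have es : s = s' by apply/eqP; rewrite eq_le ss' s's.
  move: ee; rewrite es subrr => /eqP; rewrite subr_eq0 => /eqP ->.
  by rewrite !set_itv1 !Rintegral_set1 !subrr normr0 mul0r.
pose P := \int[mu]_(x in `[s, s']) p x.
have d0 : 0 < s' - s by rewrite subr_gt0.
have [iP eP] := cst t t' P tt'.
have iq' : mu.-integrable `[t, t'] (EFin \o (fun y => q y * (s' - s))).
  by apply: eq_integrable (integrableZr _ (s' - s) iq).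
suff : `|\int[mu]_(y in `[t, t']) (P - q y * (s' - s))| <= c * (s' - s) * (t' - t).
  rewrite RintegralB// eP RintegralZr// ee -mulrBl normrM (gtr0_norm d0).
  by rewrite ler_pM2r// mulrC.
apply: bound => //.
by apply: eq_integrable (integrableB _ iP iq').
Qed.

End transport.

(** * Vanishing by characteristics *)

Section characteristics.
Variable R : realType.
Notation mu := (@lebesgue_measure R).
Notation T := (measurableTypeR R).
Notation mu2 := (mu \x mu)%E.
Variables (w : R -> R -> R) (a b : R).
Hypothesis ab : a < b.
Hypothesis iw : mu2.-integrable setT (fun z => (w z.1 z.2)%:E).
Hypothesis iw1 : forall y, mu.-integrable setT (EFin \o (fun x => w x y)).
Hypothesis iw2 : forall x, mu.-integrable setT (EFin \o (fun y => w x y)).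
Hypothesis hw : forall t s, a <= t <= b -> a <= s <= b ->
  \int[mu]_(x in `[a, t]) w x s = - \int[mu]_(y in `[a, s]) w t y.

Let U1 t s := \int[mu]_(x in `[a, t]) w x s.
Let U2 t s := \int[mu]_(y in `[a, s]) w t y.
Let W t s := \int[mu]_(y in `[a, s]) U1 t y.
Let m x := \int[mu]_y `|w x y|.
Let n y := \int[mu]_x `|w x y|.
Let Z t s := \int[mu]_(y in `[a, s]) W t y.

Let rect (f : R -> R -> R) (A B : set R) : measurable (A : set T) -> measurable (B : set T) ->
  mu2.-integrable (A `*` B) (fun z => (f z.1 z.2)%:E) ->
  [/\ mu.-integrable A (EFin \o (fun x => \int[mu]_(y in B) f x y)),
      mu.-integrable B (EFin \o (fun y => \int[mu]_(x in A) f x y)) &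
      \int[mu]_(x in A) \int[mu]_(y in B) f x y =
      \int[mu]_(y in B) \int[mu]_(x in A) f x y].
Proof.
move=> mA mB fi.
apply: (@Rfubini_region _ f (A `*` B) A B (fun=> B) (fun=> A)) => //; first exact: measurableX.
by move=> x y; split => -[].
Qed.

Let iwS (A B : set R) : measurable (A : set T) -> measurable (B : set T) ->
  mu2.-integrable (A `*` B) (fun z => (w z.1 z.2)%:E).
Proof. by move=> mA mB; apply: integrableS iw => //; exact: measurableX. Qed.

Let iU1 t : mu.-integrable setT (EFin \o U1 t).
Proof.
by have [] := @rect w `[a, t]%classic setT (measurable_itv _) measurableT (iwS (measurable_itv _) measurableT).
Qed.

Let iU2 s : mu.-integrable setT (EFin \o (fun t => U2 t s)).
Proof.
by have [] := @rect w setT `[a, s]%classic measurableT (measurable_itv _) (iwS measurableT (measurable_itv _)).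
Qed.

Let WE t s : W t s = \int[mu]_(x in `[a, t]) U2 x s.
Proof.
by have [_ _ ->] := @rect w `[a, t]%classic `[a, s]%classic (measurable_itv _) (measurable_itv _)
  (iwS (measurable_itv _) (measurable_itv _)).
Qed.

Let imn : mu.-integrable setT (EFin \o m) /\ mu.-integrable setT (EFin \o n).
Proof.
have := integrable_norm iw; move=> iN.
by have [] := @Rfubini R (fun x y => `|w x y|) iN.
Qed.

Let ge0_norm_set (f : R -> R) (A : set R) : measurable (A : set T) ->
  mu.-integrable setT (EFin \o f) -> `|\int[mu]_(x in A) f x| <= \int[mu]_x `|f x|.
Proof.
move=> mA if_.
have ifA : mu.-integrable A (EFin \o f) by exact: integrableS if_.
have inf : mu.-integrable setT (EFin \o (fun x => `|f x|)).
  by apply: eq_integrable (integrable_norm if_).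
apply: (le_trans (le_normr_Rintegral _ ifA)) => //.
rewrite [leLHS]Rintegral_mkcond; apply: le_Rintegral => //.
  rewrite -restrict_EFin -integrable_mkcond//.
  by apply: integrableS inf.
by move=> x _; rewrite patchE; case: ifP => // _; exact: normr_ge0.
Qed.

Let U1n t s : `|U1 t s| <= n s. Proof. exact: ge0_norm_set. Qed.

Let U2m t s : `|U2 t s| <= m t. Proof. exact: ge0_norm_set. Qed.

Let itv_le (f g : R -> R) (x y : R) : mu.-integrable setT (EFin \o f) ->
  mu.-integrable setT (EFin \o g) -> (forall z, `|f z| <= g z) ->
  `|\int[mu]_(z in `[x, y]) f z| <= \int[mu]_(z in `[x, y]) g z.
Proof.
move=> if_ ig fg.
have ifA : mu.-integrable `[x, y] (EFin \o f) by exact: integrableS if_.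
apply: (le_trans (le_normr_Rintegral _ ifA)) => //.
apply: le_Rintegral => //; last by exact: integrableS ig.
by apply: eq_integrable (integrable_norm ifA).
Qed.

Let N x := \int[mu]_(z in `[a, x]) m z.
Let M x := \int[mu]_(z in `[a, x]) n z.

Let itvB (g : R -> R) x y : mu.-integrable setT (EFin \o g) -> a <= x -> x <= y ->
  \int[mu]_(z in `[a, y]) g z - \int[mu]_(z in `[a, x]) g z = \int[mu]_(z in `[x, y]) g z.
Proof.
move=> ig ax xy; rewrite (Rintegral_itv_split ax xy); first by rewrite addrC addKr.
exact: integrableS ig.
Qed.

Let m0 x : 0 <= m x. Proof. by apply: Rintegral_ge0 => y _. Qed.
Let n0 x : 0 <= n x. Proof. by apply: Rintegral_ge0 => y _. Qed.

Let Nle x y : a <= x -> x <= y -> N x <= N y.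
Proof.
move=> ax xy; rewrite -subr_ge0 /N itvB//; last exact: imn.1.
by apply: Rintegral_ge0 => z _.
Qed.

Let Mle x y : a <= x -> x <= y -> M x <= M y.
Proof.
move=> ax xy; rewrite -subr_ge0 /M itvB//; last exact: imn.2.
by apply: Rintegral_ge0 => z _.
Qed.

Let Wmod t t' s s' : a <= t -> t <= t' -> a <= s -> s <= s' ->
  `|W t' s' - W t s| <= (N t' - N t) + (M s' - M s).
Proof.
move=> at_ tt' as_ ss'.
apply: (le_trans (ler_distD (W t s') _ _)); apply: lerD.
  rewrite !WE (itvB (iU2 s') at_ tt') /N (itvB imn.1 at_ tt').
  by apply: itv_le => //; exact: imn.1.
rewrite /W (itvB (iU1 t) as_ ss') /M (itvB imn.2 as_ ss').
by apply: itv_le => //; exact: imn.2.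
Qed.

Let iW1 t x y : a <= x -> mu.-integrable `[x, y] (EFin \o W t).
Proof.
move=> ax; have [iW _] := primitive_primitive a y (iU1 t).
apply: integrableS iW => //; apply: subset_itvr; by rewrite bnd_simp.
Qed.

Let iW2 s x y : a <= x -> mu.-integrable `[x, y] (EFin \o (fun t => W t s)).
Proof.
move=> ax; have [iW _] := primitive_primitive a y (iU2 s).
have sub : `[x, y]%classic `<=` `[a, y]%classic by apply: subset_itvr; rewrite bnd_simp.
rewrite (_ : (fun t => W t s) = (fun t => \int[mu]_(z in `[a, t]) U2 z s)).
  exact: integrableS iW.
by apply/funext => t; rewrite WE.
Qed.

Let ZE t s : a <= t <= b -> a <= s <= b -> Z t s = - \int[mu]_(x in `[a, t]) W x s.
Proof.
move=> tab sab; rewrite /Z (primitive_primitive a s (iU1 t)).2.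
(* The weight s - y comes from the double primitive of U1 t; with it the
   order of integration can be exchanged on w itself, so that the joint
   measurability of W is not at stake. *)
have iws : mu2.-integrable (`[a, t] `*` `[a, s]) (fun z => (w z.1 z.2 * (s - z.2))%:E).
  have ir := iwS (measurable_itv `[a, t]) (measurable_itv `[a, s]).
  have mr : measurable (`[a, t]%classic `*` `[a, s]%classic : set (T * T)) by exact: measurableX.
  have irs := integrableZl mr (s - a) ir.
  apply: le_integrable irs => //.
    apply/measurable_EFinP; apply: measurable_funM.
      by have /integrableP[/measurable_EFinP] := ir.
    by apply: measurable_funB => //; apply: measurable_funTS; exact: measurable_snd.
  move=> [x y] [/= _]; rewrite in_itv/= => /andP[ay ys].
  rewrite lee_fin !normrM mulrC ler_wpM2r//.
  by rewrite !ger0_norm ?subr_ge0 ?(le_trans ay)// lerD2l lerN2.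
have [_ _ e] := @rect (fun x y => w x y * (s - y)) `[a, t]%classic `[a, s]%classic
  (measurable_itv _) (measurable_itv _) iws.
transitivity (\int[mu]_(y in `[a, s]) \int[mu]_(x in `[a, t]) (w x y * (s - y))).
  apply: eq_Rintegral => y _; rewrite RintegralZr//.
  exact: integrableS (iw1 y).
rewrite -e.
transitivity (\int[mu]_(x in `[a, t]) ((-1) * W x s)); last first.
  rewrite RintegralZl ?mulN1r//; exact: iW2.
apply: eq_Rintegral => x; rewrite inE/= in_itv/= => /andP[ax xt].
(* The weight s - y disappears again, now for the primitive of w x. *)
rewrite -(primitive_primitive a s (iw2 x)).2 /W.
rewrite -RintegralZl//; last by exact: integrableS (iU1 x).
apply: eq_Rintegral => y; rewrite inE/= in_itv/= => /andP[ay ys].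
rewrite mulN1r /U1 hw ?opprK//.
  by rewrite ax (le_trans xt)//; have /andP[] := tab.
by rewrite ay (le_trans ys)//; have /andP[] := sab.
Qed.

(* Moving t changes Z by an integral of - W, moving s by one of + W; on a small
   square the two almost cancel, by the continuity of W. *)
Let Zdiag t t' s s' : a <= t -> t <= t' -> t' <= b -> a <= s -> s <= s' -> s' <= b ->
  t' - t = s' - s -> `|Z t' s' - Z t s| <= (t' - t) * ((N t' - N t) + (M s' - M s)).
Proof.
move=> at_ tt' t'b as_ ss' s'b e.
have at' := le_trans at_ tt'; have as' := le_trans as_ ss'.
have tb := le_trans tt' t'b; have sb := le_trans ss' s'b.
rewrite -(subrKA (Z t' s)).
have -> : Z t' s' - Z t' s = \int[mu]_(y in `[s, s']) W t' y.
  by rewrite /Z (Rintegral_itv_split as_ ss') ?iW1// addrC addKr.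
have -> : Z t' s - Z t s = - \int[mu]_(x in `[t, t']) W x s.
  rewrite !ZE ?at_ ?at' ?as_ ?tb//.
  by rewrite (Rintegral_itv_split at_ tt') ?iW2// opprK opprD addrAC addNr add0r.
apply: pivot_bound => //; [exact: iW1|exact: iW2|].
move=> y x /andP[sy ys'] /andP[tx xt'].
have ax := le_trans at_ tx.
apply: (le_trans (Wmod ax xt' as_ sy)); apply: lerD.
  by rewrite lerD2l lerN2 Nle.
by rewrite lerD2r Mle// (le_trans as_).
Qed.

Let Zconst t s d : a <= t -> a <= s -> 0 <= d -> t + d <= b -> s + d <= b ->
  Z (t + d) (s + d) = Z t s.
Proof.
move=> at_ as_ d0 tb sb.
have := @quadratic_increments_constant R (fun r => Z (t + r) (s + r))
  (fun r => N (t + r) + M (s + r)) 0 d d0.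
rewrite !addr0; apply => x x' x0 xx' x'd.
rewrite (_ : x' - x = (t + x') - (t + x)); last by ring.
rewrite [X in _ <= _ * X](_ : _ = (N (t + x') - N (t + x)) + (M (s + x') - M (s + x))); last first.
  by rewrite opprD addrACA.
apply: Zdiag; rewrite ?lerD2l//; try lra.
Qed.

Let Z0 t s : a <= t <= b -> a <= s <= b -> Z t s = 0.
Proof.
move=> tab sab; have /andP[at_ tb] := tab; have /andP[as_ sb] := sab.
(* Follow the diagonal down to the side s = a or to the side t = a. *)
have [st|/ltW ts] := leP s t.
  rewrite (_ : t = a + (t - s) + (s - a)); last by ring.
  rewrite [X in Z _ X](_ : s = a + (s - a)); last by ring.
  rewrite Zconst ?subr_ge0//; [|lra|lra|lra].
  by rewrite /Z set_itv1 Rintegral_set1.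
rewrite (_ : s = a + (s - t) + (t - a)); last by ring.
rewrite [X in Z X _](_ : t = a + (t - a)); last by ring.
rewrite Zconst ?subr_ge0//; [|lra|lra|lra].
rewrite ZE ?lexx ?(ltW ab)//; last lra.
by rewrite set_itv1 Rintegral_set1 oppr0.
Qed.

(** Formally w = d(U1)/dt with U1 = - U2, and the relation says that the double
    primitives of w satisfy dZ/dt + dZ/ds = 0 with zero values on the sides
    t = a and s = a. *)
Lemma characteristics0 t s : a <= t <= b -> a < s < b ->
  \int[mu]_(y in `[a, s]) w t y = 0 /\ \int[mu]_(x in `[a, t]) w x s = 0.
Proof.
move=> tab sab.
have main : \int[mu]_(y in `[a, s]) w t y = 0.
  apply: primitive_primitive0 sab => // x xab.
  have xab' : a <= x <= b by have /andP[? ?] := xab; rewrite !ltW.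
  have : W t x = 0.
    apply: primitive_primitive0 xab => // z /andP[az zb].
    by apply: Z0 => //; rewrite !ltW.
  rewrite /W => e; transitivity (\int[mu]_(y in `[a, x]) ((-1) * U1 t y)).
    apply: eq_Rintegral => y; rewrite inE/= in_itv/= => /andP[ay yx].
    rewrite mulN1r /U1 hw ?opprK// ay (le_trans yx)//.
    by have /andP[] := xab'.
  rewrite RintegralZl// ?e ?mulr0//; exact: integrableS (iU1 t).
split=> //; rewrite hw ?main ?oppr0//.
by have /andP[? ?] := sab; rewrite !ltW.
Qed.

End characteristics.

(** * Borel measurability of derivatives *)

Section measurable_derivative.
Variable R : realType.
Notation mu := (@lebesgue_measure R).
Notation T := (measurableTypeR R).

Section slope.
Variable f : R -> R.
Hypothesis cf : continuous f.

Let slope (x h : R) : R := h^-1 * (f (h + x) - f x).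

Let slope_continuous h : continuous (slope ^~ h).
Proof.
move=> x; apply: cvgM; first exact: cvg_cst.
apply: cvgB; last exact: cf.
apply: (@continuous_comp _ _ _ (fun z => h + z) f); last exact: cf.
by apply: cvgD; [exact: cvg_cst|exact: cvg_id].
Qed.

Let C (k n : nat) := [set x : R | forall h h', 0 < `|h| < n.+1%:R^-1 ->
  0 < `|h'| < n.+1%:R^-1 -> `|slope x h - slope x h'| <= k.+1%:R^-1].

Let closedC k n : closed (C k n).
Proof.
rewrite (_ : C k n = \bigcap_(p in [set p : R * R |
    (0 < `|p.1| < n.+1%:R^-1) && (0 < `|p.2| < n.+1%:R^-1)])
    [set x | `|slope x p.1 - slope x p.2| <= k.+1%:R^-1]); last first.
  apply/seteqP; split => x /= H; first by move=> [h h'] /= /andP[]; exact: H.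
  by move=> h h' hn hn'; apply: (H (h, h')); rewrite /= hn.
apply: closed_bigI => -[h h'] _ /=.
rewrite (_ : [set x | _] = (fun x => `|slope x h - slope x h'|) @^-1` [set z | z <= k.+1%:R^-1])//.
apply: preimage_closed; last exact: closed_le.
move=> x _; apply: cvg_norm; apply: cvgB; exact: slope_continuous.
Qed.

Let D : set R := \bigcap_k \bigcup_n C k n.

Let slopeE x : (fun h => h^-1 *: (f (h *: 1 + x) - f x)) = slope x.
Proof. by apply/funext => h; rewrite /slope [h *: 1]mulr1. Qed.

Let cvgD x : D x <-> cvg (slope x h @[h --> 0^']).
Proof.
split.
  move=> Dx; apply/cauchy_cvgP; apply: cauchy_exP => e e0.
  have [k] := ltr_add_invr e0; rewrite add0r => ke.
  have [n _ Cx] := Dx k I.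
  (* Any admissible increment serves as the centre of the Cauchy ball. *)
  pose h0 : R := n.+1%:R^-1 / 2.
  have n0 : 0 < n.+1%:R^-1 :> R by rewrite invr_gt0.
  have h00 : 0 < `|h0| < n.+1%:R^-1.
    have h0p : 0 < h0 by rewrite /h0 divr_gt0.
    by rewrite (gtr0_norm h0p) h0p/= /h0 gtr_pMr// invf_lt1// ltr1n.
  exists (slope x h0).
  rewrite /nbhs/= /dnbhs/= /within/=.
  exists n.+1%:R^-1 => //= h; rewrite /ball/= sub0r normrN => hn hne.
  apply: le_lt_trans ke; apply: Cx => //.
  by rewrite hn andbT normr_gt0.
move=> /cvg_ex[l /cvgrPdist_lt sl] k _.
have k0 : 0 < k.+1%:R^-1 / 2 :> R by rewrite divr_gt0 ?invr_gt0.
have := sl _ k0; rewrite /nbhs/= /dnbhs/= /within/= => -[d d0 dl].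
have [n] := ltr_add_invr d0; rewrite add0r => nd.
exists n => // h h' /andP[h0 hn] /andP[h'0 h'n].
have near z : 0 < `|z| -> `|z| < n.+1%:R^-1 -> `|l - slope x z| < k.+1%:R^-1 / 2.
  move=> z0 zn; apply: dl; last by rewrite -normr_gt0.
  by rewrite /ball/= sub0r normrN (lt_trans zn).
rewrite (le_trans (ler_distD l _ _))// [leRHS]splitr; apply: lerD; apply: ltW.
  by rewrite distrC near.
exact: near.
Qed.

(** The points of differentiability form a Borel set by the Cauchy criterion for
    slopes: for fixed bounds on the increments the condition is closed.  On this
    set the derivative is a limit of continuous functions, and elsewhere the
    limit operator takes its default value. *)
Lemma measurable_derive1 : measurable_fun setT (derive1 f : T -> R).
Proof.
have mD : measurable (D : set T).
  apply: bigcap_measurable => // k _; apply: bigcup_measurable => n _.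
  exact: closed_measurable.
rewrite -(setUv D); apply/measurable_funU => //; first exact: measurableC.
split.
- apply: (@measurable_fun_cvg _ _ _ _ (fun n => slope ^~ (harmonic n))).
    move=> n; apply: measurable_funTS; apply: continuous_measurable_fun.
    exact: slope_continuous.
  move=> x /cvgD /cvg_ex[l sl].
  have -> : derive1 f x = l.
    rewrite derive1E /derive; apply/cvg_lim => //.
    by have := sl; rewrite -slopeE.
  move/cvgr_dnbhsP : sl; apply; split; last exact: cvg_harmonic.
  by move=> n; rewrite gt_eqF// /harmonic invr_gt0.
- apply: (@eq_measurable_fun _ _ _ _ _ (fun=> point : R)).
    move=> x /set_mem Dx; rewrite derive1E /derive dvgP//.
    by move=> c; apply: Dx; apply/cvgD; rewrite -slopeE.
  exact: measurable_cst.
Qed.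
End slope.

Lemma ae_derive_density (a b : R) (y phi : R -> R) :
  mu.-integrable setT (EFin \o phi) ->
  (forall x, a <= x <= b -> y x = y a + \int[mu]_(t in `[a, x]) phi t) ->
  {ae mu, forall x, a < x < b -> is_derive x 1 y (phi x)}.
Proof.
move=> iphi yE; have := ae_derive_primitive a iphi.
apply: filterS; first exact: (ae_filter_ringOfSetsType mu).
move=> x H xab; have /andP[ax xb] := xab.
apply: (@near_itv_is_derive _ (fun z => y a + \int[mu]_(t in `[a, z]) phi t) _ a b) => //.
  by move=> z /andP[az zb]; rewrite [RHS]yE// !ltW.
have := is_deriveD (is_derive_cst (y a) x 1) (H ax).
by rewrite add0r.
Qed.

Lemma measurable_derive1_itv (a b : R) (y : R -> R) : a < b ->
  absolutely_continuous_on a b y ->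
  measurable_fun (`]a, b[%classic : set T) (derive1 y).
Proof.
move=> ab acy.
have cY : continuous (fun x => y (clip a b x)).
  by apply: absolutely_continuous_clip => //; exact: ltW.
apply: (@eq_measurable_fun _ _ _ _ _ (derive1 (fun x => y (clip a b x)))).
  move=> x; rewrite inE/= => xab.
  rewrite !derive1E; apply: near_eq_derive.
  have := near_in_itvoo xab.
  by apply: filterS => z; rewrite in_itv/= => /andP[az zb]; rewrite clip_id ?ltW// !ltW.
by apply: measurable_funTS; exact: measurable_derive1.
Qed.

End measurable_derivative.

(** * Difference kernels *)

Section difference_kernel.
Variable R : realType.
Notation mu := (@lebesgue_measure R).
Notation T := (measurableTypeR R).
Notation mu2 := (mu \x mu)%E.

(** The kernel h is given by K t a on the positive half-line and by K a s on the
    negative one.  The function K t s - h (t - s) then satisfies the hypothesis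
    of [characteristics0]: the identity for K and the one for h have the same
    right-hand side, since both sides are determined by their restrictions to
    t = a and s = a. *)
Lemma difference_kernel (K : R -> R -> R) (f g : R -> R) (a b : R) : a < b ->
  mu2.-integrable (`[a, b] `*` `[a, b]) (fun z => (K z.1 z.2)%:E) ->
  (forall t s, a <= t <= b -> a <= s <= b ->
    [/\ mu.-integrable `[a, t] (fun x => (K x s)%:E),
        mu.-integrable `[a, s] (fun x => (K t x)%:E) &
        \int[mu]_(x in `[a, t]) K x s + \int[mu]_(x in `[a, s]) K t x = g t + f s]) ->
  exists2 h : R -> R, mu.-integrable setT (EFin \o h) &
    [/\ forall t, a < t <= b -> K t a = h (t - a),
        forall t, a <= t <= b -> {ae mu, forall s, a < s < b -> K t s = h (t - s)} &
        forall s, a < s < b -> {ae mu, forall t, a < t < b -> K t s = h (t - s)}].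
Proof.
move=> ab iK hK.
have aab : a <= a <= b by rewrite lexx ltW.
have bab : a <= b <= b by rewrite lexx ltW.
pose u : R -> R := (fun x => K x a) \_ `[a, b].
pose v : R -> R := (fun x => K a x) \_ `[a, b].
have iu : mu.-integrable setT (EFin \o u).
  rewrite /u -restrict_EFin -integrable_mkcond//.
  by have [] := hK b a bab aab.
have iv : mu.-integrable setT (EFin \o v).
  rewrite /v -restrict_EFin -integrable_mkcond//.
  by have [] := hK a b aab bab.
(* Both summands are nonzero only at s = 0, which is a null set. *)
pose h s := u (s - - a) + v (a - s).
have uE x : a <= x <= b -> u x = K x a by move=> xab; rewrite /u patchE mem_set//= in_itv.
have vE x : a <= x <= b -> v x = K a x by move=> xab; rewrite /v patchE mem_set//= in_itv.
have u0 x : x < a -> u x = 0.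
  by move=> xa; rewrite /u patchE memNset//= in_itv/= leNgt xa.
have v0 x : x < a -> v x = 0.
  by move=> xa; rewrite /v patchE memNset//= in_itv/= leNgt xa.
have ih : mu.-integrable setT (EFin \o h).
  apply: eq_integrable (integrableD measurableT (integrable_shift (- a) iu) (integrable_rev a iv)) => //.
have hl t : a < t <= b -> h (t - a) = K t a.
  move=> /andP[ta tb]; rewrite /h v0; last lra.
  by rewrite addr0 (_ : t - a - - a = t) ?uE ?(ltW ta)//; ring.
have hr s : a < s <= b -> h (a - s) = K a s.
  move=> /andP[sa sb]; rewrite /h u0; last lra.
  by rewrite add0r (_ : a - (a - s) = s) ?vE ?(ltW sa)//; ring.
have openE (F G : R -> R) t : mu.-integrable `[a, t] (EFin \o F) -> mu.-integrable `[a, t] (EFin \o G) ->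
    (forall x, a < x <= t -> F x = G x) -> \int[mu]_(x in `[a, t]) F x = \int[mu]_(x in `[a, t]) G x.
  move=> iF iG FG.
  rewrite -!(@Rintegral_itv_obnd_cbnd _ a (BRight t)).
  - by apply: eq_Rintegral => x; rewrite inE/= in_itv/=; exact: FG.
  - by apply: integrableS iG => //; apply: subset_itvr; rewrite bnd_simp.
  - by apply: integrableS iF => //; apply: subset_itvr; rewrite bnd_simp.
have iS r t : mu.-integrable `[a, t] (EFin \o (fun x => h (x - r))).
  by apply: integrableS (integrable_shift r ih).
have iR r t : mu.-integrable `[a, t] (EFin \o (fun x => h (r - x))).
  by apply: integrableS (integrable_rev r ih).
(* Extending w by zero makes all its sections integrable on the line. *)
pose inQ x y := (a <= x <= b) && (a <= y <= b).
pose w x y := if inQ x y then K x y - h (x - y) else 0.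
have mI : measurable (`[a, b]%classic : set T) by exact: measurable_itv.
have mQ : measurable (`[a, b]%classic `*` `[a, b]%classic : set (T * T)) by exact: measurableX.
have iw : mu2.-integrable setT (fun z => (w z.1 z.2)%:E).
  have ih2 : mu2.-integrable (`[a, b] `*` `[a, b]) (fun z : T * T => (h (z.1 - z.2))%:E).
    pose c : R -> R := (fun=> 1 : R) \_ `[a, b].
    have ic : mu.-integrable setT (EFin \o c).
      rewrite /c -restrict_EFin -integrable_mkcond//; exact: integrable_itv_cst.
    have := (integrable_convolution_kernel ih ic).1.
    move=> /(integrableS measurableT mQ (@subsetT _ _)); apply: eq_integrable => //.
    move=> [x y]; rewrite inE/= => -[_ yab]; congr EFin.
    by rewrite /c patchE mem_set// mulr1.
  have := integrableB mQ iK ih2; rewrite (integrable_mkcond _ mQ).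
  apply: eq_integrable => // -[x y] _; rewrite patchE /w /inQ /=.
  case: ifPn => [/set_mem[]|]; first by rewrite /= !in_itv/= => -> ->.
  by case: ifPn => // xy; rewrite mem_set//= !in_itv/=; apply/andP.
have iw1 y : mu.-integrable setT (EFin \o (fun x => w x y)).
  have [yab|yab] := boolP (a <= y <= b); last first.
    rewrite (_ : (fun x => w x y) = fun=> 0); first exact: integrable0.
    by apply/funext => x; rewrite /w /inQ (negbTE yab) andbF.
  have [iKy _ _] := hK b y bab yab.
  have := integrableB mI iKy (iS y b).
  rewrite (integrable_mkcond _ mI); apply: eq_integrable => // x _.
  rewrite patchE /= /w /inQ yab andbT; case: ifPn => [/set_mem|].
    by rewrite /= in_itv/= => ->.
  by case: ifPn => // xab; rewrite mem_set//= in_itv.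
have iw2 x : mu.-integrable setT (EFin \o (fun y => w x y)).
  have [xab|xab] := boolP (a <= x <= b); last first.
    rewrite (_ : (fun y => w x y) = fun=> 0); first exact: integrable0.
    by apply/funext => y; rewrite /w /inQ (negbTE xab).
  have [_ iKx _] := hK x b xab bab.
  have := integrableB mI iKx (iR x b).
  rewrite (integrable_mkcond _ mI); apply: eq_integrable => // y _.
  rewrite patchE /= /w /inQ xab /=; case: ifPn => [/set_mem|].
    by rewrite /= in_itv/= => ->.
  by case: ifPn => // yab; rewrite mem_set//= in_itv.
have hw t s : a <= t <= b -> a <= s <= b ->
    \int[mu]_(x in `[a, t]) w x s = - \int[mu]_(y in `[a, s]) w t y.
  move=> tab sab; have /andP[at_ tb] := tab; have /andP[as_ sb] := sab.
  have [i1 i2 e] := hK t s tab sab.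
  have [j1 _ e1] := hK t a tab aab.
  have [_ j2 e2] := hK a s aab sab.
  have [_ _ e0] := hK a a aab aab.
  have -> : \int[mu]_(x in `[a, t]) w x s =
      \int[mu]_(x in `[a, t]) K x s - \int[mu]_(x in `[a, t]) h (x - s).
    rewrite -RintegralB//; apply: eq_Rintegral => x; rewrite inE/= in_itv/= => /andP[ax xt].
    by rewrite /w /inQ sab andbT ax (le_trans xt).
  have -> : \int[mu]_(y in `[a, s]) w t y =
      \int[mu]_(y in `[a, s]) K t y - \int[mu]_(y in `[a, s]) h (t - y).
    rewrite -RintegralB//; apply: eq_Rintegral => y; rewrite inE/= in_itv/= => /andP[ay ys].
    by rewrite /w /inQ tab ay (le_trans ys).
  (* At the endpoint a itself h (t - a) need not be K t a, hence the open intervals. *)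
  have E1 : \int[mu]_(x in `[a, t]) K x a = \int[mu]_(x in `[a, t]) h (x - a).
    apply: openE => // x /andP[ax xt]; rewrite hl// ax/=; exact: le_trans tb.
  have E2 : \int[mu]_(y in `[a, s]) K a y = \int[mu]_(y in `[a, s]) h (a - y).
    apply: openE => // y /andP[ay ys]; rewrite hr// ay/=; exact: le_trans sb.
  move: e1 e2 e0; rewrite !set_itv1 !Rintegral_set1 addr0 add0r addr0 E1 E2.
  rewrite !Rintegral_shift// !Rintegral_rev// !subrr.
  have ihT x y : mu.-integrable `[x, y] (EFin \o h) by exact: integrableS ih.
  have S1 : \int[mu]_(x in `[a - s, t - a]) h x =
      \int[mu]_(x in `[a - s, t - s]) h x + \int[mu]_(x in `[t - s, t - a]) h x.
    by apply: Rintegral_itv_split => //; rewrite ?lerD2r ?lerD2l ?lerN2.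
  have S2 : \int[mu]_(x in `[a - s, t - a]) h x =
      \int[mu]_(x in `[a - s, 0]) h x + \int[mu]_(x in `[0, t - a]) h x.
    by apply: Rintegral_itv_split => //; rewrite ?subr_le0 ?subr_ge0.
  by move: e S1 S2; lra.
have ch := characteristics0 ab iw iw1 iw2 hw.
exists h => //; split.
- by move=> t tab; rewrite hl.
- move=> t tab; have := primitive0_ae (iw2 t) (fun s sab => (ch t s tab sab).1).
  apply: filterS; first exact: (ae_filter_ringOfSetsType mu).
  move=> s H sab; have := H sab; rewrite /w /inQ tab.
  have -> : a <= s <= b by have /andP[? ?] := sab; rewrite !ltW.
  by move=> /eqP; rewrite subr_eq0 => /eqP.
- move=> s sab; have sab' : a <= s <= b by have /andP[? ?] := sab; rewrite !ltW.
  have H t : a < t < b -> \int[mu]_(x in `[a, t]) w x s = 0.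
    by move=> /andP[at_ tb]; apply: (ch t s _ sab).2; rewrite !ltW.
  have := primitive0_ae (iw1 s) H; apply: filterS; first exact: (ae_filter_ringOfSetsType mu).
  move=> t Ht tab; have := Ht tab; rewrite /w /inQ sab' andbT.
  have -> : a <= t <= b by have /andP[? ?] := tab; rewrite !ltW.
  by move=> /eqP; rewrite subr_eq0 => /eqP.
Qed.

End difference_kernel.

(** * Derivatives of generalized fractional integrals *)

Section ae_tools.
Variable R : realType.
Notation mu := (@lebesgue_measure R).
Notation T := (measurableTypeR R).

Lemma ae_neq (c : R) : {ae mu, forall x : R, x != c}.
Proof.
exists [set c]; split; [exact: measurable_set1|exact: lebesgue_measure_set1|].
by move=> x /= /negP; rewrite negbK => /eqP.
Qed.

(** Integrability asks for Borel measurability, which almost everywhere equality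
    does not transport; hence the hypothesis on f. *)
Lemma ae_eq_integrable_Rintegral (D : set R) (f g : R -> R) : measurable (D : set T) ->
  measurable_fun (D : set T) f -> mu.-integrable D (EFin \o g) ->
  {ae mu, forall x, D x -> f x = g x} ->
  mu.-integrable D (EFin \o f) /\ \int[mu]_(x in D) f x = \int[mu]_(x in D) g x.
Proof.
move=> mD mf ig fg.
have mg : measurable_fun (D : set T) (EFin \o g) by exact: measurable_int ig.
have mEf : measurable_fun (D : set T) (EFin \o f) by exact/measurable_EFinP.
have fgE : ae_eq mu D (EFin \o f) (EFin \o g).
  move: fg; apply: filterS; first exact: (ae_filter_ringOfSetsType mu).
  by move=> x fgx Dx /=; rewrite fgx.
split; last by rewrite /Rintegral; congr fine; exact: ae_eq_integral.
apply/integrableP; split => //.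
have -> : (\int[mu]_(x in D) `|(EFin \o f) x| = \int[mu]_(x in D) `|(EFin \o g) x|)%E.
  apply: ae_eq_integral => //; [exact: measurableT_comp|exact: measurableT_comp|].
  exact: ae_eq_abse.
by have /integrableP[] := ig.
Qed.

Lemma integrableM_bounded (D : set R) (f y : R -> R) (C : R) : measurable (D : set T) ->
  measurable_fun (D : set T) y -> (forall x, D x -> `|y x| <= C) ->
  mu.-integrable D (EFin \o f) -> mu.-integrable D (fun x => (f x * y x)%:E).
Proof.
move=> mD my yC if_.
apply: (le_integrable mD _ _ (integrableZl mD C if_)).
  apply/measurable_EFinP; apply: measurable_funM => //.
  by have /integrableP[/measurable_EFinP] := if_.
move=> x Dx; rewrite lee_fin !normrM mulrC ler_wpM2r//.
by rewrite (le_trans (yC _ Dx))// ler_norm.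
Qed.

End ae_tools.

Theorem theorem3p1 (R : realType) (alpha : R) (P : param_set R)
    (k : R -> R -> R -> R) (y : R -> R)
    (halpha : 0 < alpha < 1) (hab : pa P < pb P)
    (hy : absolutely_continuous_on (pa P) (pb P) y)
    (hk : kernel_integrable (pa P) (pb P) (k (1 - alpha)))
    (hfg : exists f g : R -> R, forall t tau : R,
      t \in `[pa P, pb P] -> tau \in `[pa P, pb P] ->
      [/\ lebesgue_measure.-integrable `[pa P, t]
            (fun theta => (k (1 - alpha) theta tau)%:E),
          lebesgue_measure.-integrable `[pa P, tau]
            (fun theta => (k (1 - alpha) t theta)%:E) &
          \int[lebesgue_measure]_(theta in `[pa P, t]) k (1 - alpha) theta tau
          + \int[lebesgue_measure]_(theta in `[pa P, tau]) k (1 - alpha) t theta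
          = g t + f tau]) :
  (forall t : R, t \in `[pa P, pb P] -> gfi_defined k P (1 - alpha) y t) /\
  {ae lebesgue_measure, forall t : R, t \in `[pa P, pb P] ->
    [/\ gRL_defined k P alpha y t,
        gCaputo_defined k P alpha y t &
        gRL k P alpha y t =
          pp P * y (pa P) * k (1 - alpha) t (pa P)
          - pq P * y (pb P) * k (1 - alpha) (pb P) t
          + gCaputo k P alpha y t]}.
Proof.
move: hfg => [f [g hK]].
move: hab hy hk hK; rewrite /kernel_integrable.
set a := pa P; set b := pb P; set K := k (1 - alpha); set p := pp P; set q := pq P.
move=> ab acy iK hK0.
have hK t s : a <= t <= b -> a <= s <= b ->
    [/\ lebesgue_measure.-integrable `[a, t] (fun x => (K x s)%:E),
        lebesgue_measure.-integrable `[a, s] (fun x => (K t x)%:E) &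
        \int[lebesgue_measure]_(x in `[a, t]) K x s +
        \int[lebesgue_measure]_(x in `[a, s]) K t x = g t + f s].
  by move=> tab sab; apply: hK0; rewrite in_itv.
have aab : a <= a <= b by rewrite lexx ltW.
have bab : a <= b <= b by rewrite lexx ltW.
have [h ih [hl hrow hcol]] := difference_kernel ab iK hK.
have [phi iphi yE] := absolutely_continuous_density ab acy.
have yc := absolutely_continuous_within (ltW ab) acy.
have my : measurable_fun `[a, b]%classic y.
  by apply: subspace_continuous_measurable_fun => //; exact: measurable_itv.
have [C yC] : exists C, forall x, a <= x <= b -> `|y x| <= C.
  have [c1 _ h1] := EVT_max (ltW ab) yc; have [c2 _ h2] := EVT_min (ltW ab) yc.
  exists (`|y c1| + `|y c2|) => x xab.
  have := h1 x; have := h2 x; rewrite !in_itv/= => /(_ xab) k2 /(_ xab) k1.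
  rewrite ler_norml; have := ler_norm (y c1); have := normr_ge0 (y c1).
  by have := ler_norm (- y c2); have := normr_ge0 (y c2); rewrite normrN; lra.
have mdy := measurable_derive1_itv ab acy.
have sub1 t : a <= t <= b -> `[a, t]%classic `<=` `[a, b]%classic.
  by move=> /andP[_ tb]; apply: subset_itvl; rewrite bnd_simp.
have sub2 t : a <= t <= b -> `[t, b]%classic `<=` `[a, b]%classic.
  by move=> /andP[at_ _]; apply: subset_itvr; rewrite bnd_simp.
have iKl t : a <= t <= b -> lebesgue_measure.-integrable `[a, t] (fun x => (K t x)%:E).
  by move=> tab; have [] := hK t t tab tab.
have iKr t : a <= t <= b -> lebesgue_measure.-integrable `[t, b] (fun x => (K x t)%:E).
  move=> tab; have [ib _ _] := hK b t bab tab.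
  by apply: integrableS ib => //; exact: sub2.
have def t : a <= t <= b -> 
    lebesgue_measure.-integrable `[a, t] (fun x => (K t x * y x)%:E) /\
    lebesgue_measure.-integrable `[t, b] (fun x => (K x t * y x)%:E).
  move=> tab; split.
    apply: (@integrableM_bounded _ _ (K t) y C) => //; last exact: iKl.
      by apply: measurable_funS my => //; exact: sub1.
    by move=> x /(sub1 _ tab); rewrite /= in_itv/=; exact: yC.
  apply: (@integrableM_bounded _ _ (K ^~ t) y C) => //; last exact: iKr.
    by apply: measurable_funS my => //; exact: sub2.
  by move=> x /(sub2 _ tab); rewrite /= in_itv/=; exact: yC.
split=> [t|]; first by rewrite in_itv/=; exact: def.
have [mK1 mK2] : (forall t, a <= t <= b -> measurable_fun `[a, t]%classic (K t)) /\
    (forall t, a <= t <= b -> measurable_fun `[t, b]%classic (K ^~ t)).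
  by split => t tab; [have /integrableP[/measurable_EFinP] := iKl t tab|
    have /integrableP[/measurable_EFinP] := iKr t tab].
have na := ae_neq a; have nb := ae_neq b.
have hrow' t : a <= t <= b -> {ae lebesgue_measure, forall s, a <= s <= b -> K t s = h (t - s)}.
  move=> tab; move: na nb (hrow t tab).
  apply: filterS3; first exact: (ae_filter_ringOfSetsType lebesgue_measure).
  move=> s sa sb H /andP[as_ sb']; apply: H.
  by rewrite !lt_neqAle eq_sym sa sb as_ sb'.
have hcol' s : a < s < b -> {ae lebesgue_measure, forall t, a <= t <= b -> K t s = h (t - s)}.
  move=> sab; move: na nb (hcol s sab).
  apply: filterS3; first exact: (ae_filter_ringOfSetsType lebesgue_measure).
  move=> t ta tb H /andP[at_ tb']; apply: H.
  by rewrite !lt_neqAle eq_sym ta tb at_ tb'.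
(* Both integrals in gfi only see the difference kernel h. *)
have swap1 t (u v : R -> R) : a <= t <= b -> measurable_fun `[a, b]%classic u ->
    lebesgue_measure.-integrable `[a, t] (EFin \o (fun s => h (t - s) * v s)) ->
    {ae lebesgue_measure, forall s, a <= s <= b -> u s = v s} ->
    lebesgue_measure.-integrable `[a, t] (EFin \o (fun s => K t s * u s)) /\
    \int[lebesgue_measure]_(s in `[a, t]) (K t s * u s) =
    \int[lebesgue_measure]_(s in `[a, t]) (h (t - s) * v s).
  move=> tab mu_ iv uv; apply: ae_eq_integrable_Rintegral => //.
    apply: measurable_funM; first exact: mK1.
    by apply: measurable_funS mu_ => //; exact: sub1.
  move: uv (hrow' t tab); apply: filterS2; first exact: (ae_filter_ringOfSetsType lebesgue_measure).
  move=> s us Ks /(sub1 _ tab); rewrite /= in_itv/= => sab.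
  by rewrite us// Ks.
have swap2 t (u v : R -> R) : a < t < b -> measurable_fun `[a, b]%classic u ->
    lebesgue_measure.-integrable `[t, b] (EFin \o (fun s => h (s - t) * v s)) ->
    {ae lebesgue_measure, forall s, a <= s <= b -> u s = v s} ->
    lebesgue_measure.-integrable `[t, b] (EFin \o (fun s => K s t * u s)) /\
    \int[lebesgue_measure]_(s in `[t, b]) (K s t * u s) =
    \int[lebesgue_measure]_(s in `[t, b]) (h (s - t) * v s).
  move=> tab mu_ iv uv; have tab' : a <= t <= b by have /andP[? ?] := tab; rewrite !ltW.
  apply: ae_eq_integrable_Rintegral => //.
    apply: measurable_funM; first exact: mK2.
    by apply: measurable_funS mu_ => //; exact: sub2.
  move: uv (hcol' t tab); apply: filterS2; first exact: (ae_filter_ringOfSetsType lebesgue_measure).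
  move=> s us Ks /(sub2 _ tab'); rewrite /= in_itv/= => sab.
  by rewrite us// Ks.
have gfiE z : a < z < b -> gfi k P (1 - alpha) y z =
    p * \int[lebesgue_measure]_(s in `[a, z]) (h (z - s) * y s) +
    q * \int[lebesgue_measure]_(s in `[z, b]) (h (s - z) * y s).
  move=> zab; have zab' : a <= z <= b by have /andP[? ?] := zab; rewrite !ltW.
  have yy : {ae lebesgue_measure, forall s, a <= s <= b -> y s = y s} by exact: aeW.
  rewrite /gfi -/a -/b -/K -/p -/q; congr (p * _ + q * _).
  - apply: (swap1 z y y zab' my _ yy).2.
    apply: (@integrableM_bounded _ _ (fun s => h (z - s)) y C) => //.
    + by apply: measurable_funS my => //; exact: sub1.
    + by move=> x /(sub1 _ zab'); rewrite /= in_itv/=; exact: yC.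
    + by apply: integrableS (integrable_rev z ih).
  - apply: (swap2 z y y zab my _ yy).2.
    apply: (@integrableM_bounded _ _ (fun s => h (s - z)) y C) => //.
    + by apply: measurable_funS my => //; exact: sub2.
    + by move=> x /(sub2 _ zab'); rewrite /= in_itv/=; exact: yC.
    + by apply: integrableS (integrable_shift z ih).
have dy := ae_derive_density iphi yE.
have dyE : {ae lebesgue_measure, forall s, a <= s <= b -> derive1 y s = phi s}.
  move: na nb dy; apply: filterS3; first exact: (ae_filter_ringOfSetsType lebesgue_measure).
  move=> s sa sb H /andP[as_ sb']; rewrite derive1E.
  have [|_ ->//] := H; by rewrite !lt_neqAle eq_sym sa sb as_ sb'.
have mdy' : measurable_fun `[a, b]%classic (derive1 y).
  by apply/measurable_fun_itv_bndo_bndcP; apply/measurable_fun_itv_obnd_cbndP.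
have D1 := convolution_left_derive ih iphi yE.
have D2 := convolution_right_derive ih iphi yE.
have Kb := hrow' b bab.
have FF := ae_filter_ringOfSetsType (@lebesgue_measure R).
(* The two endpoints form a null set; inside, the operators are derivatives of
   the two convolutions. *)
have interior : {ae lebesgue_measure, forall t, a < t < b ->
    [/\ gRL_defined k P alpha y t, gCaputo_defined k P alpha y t &
      gRL k P alpha y t = p * y a * K t a - q * y b * K b t + gCaputo k P alpha y t]}.
  move: D1 D2 Kb; apply: filterS3 => t H1 H2 H3 tab.
  have tab' : a <= t <= b by have /andP[? ?] := tab; rewrite !ltW.
  have [i1 d1] := H1 tab; have [i2 d2] := H2 tab.
  have [j1 e1] : lebesgue_measure.-integrable `[a, t] (EFin \o (fun s => K t s * derive1 y s)) /\
      \int[lebesgue_measure]_(s in `[a, t]) (K t s * derive1 y s) =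
      \int[lebesgue_measure]_(s in `[a, t]) (h (t - s) * phi s).
    by apply: swap1 => //; apply: integrableS i1.
  have [j2 e2] : lebesgue_measure.-integrable `[t, b] (EFin \o (fun s => K s t * derive1 y s)) /\
      \int[lebesgue_measure]_(s in `[t, b]) (K s t * derive1 y s) =
      \int[lebesgue_measure]_(s in `[t, b]) (h (s - t) * phi s).
    by apply: swap2 => //; apply: integrableS i2.
  have d : is_derive t 1 (gfi k P (1 - alpha) y) _ :=
    near_itv_is_derive tab (fun z zab => esym (gfiE z zab))
      (is_deriveD (is_deriveZ p d1) (is_deriveZ q d2)).
  have [dd de] := d; split.
  - exact: dd.
  - split; last by split.
    move: dy; apply: filterS => s Hs; rewrite in_itv/= => sab.
    by have [] := Hs sab.
  - rewrite /gRL derive1E de /gCaputo /gfi -/a -/b -/K -/p -/q e1 e2.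
    rewrite H3// hl; last by have /andP[-> /ltW] := tab.
    by rewrite /GRing.scale/=; ring.
move: na nb interior; apply: filterS3 => t ta tb H; rewrite in_itv/= => /andP[at_ tb'].
by apply: H; rewrite !lt_neqAle eq_sym ta tb at_ tb'.
Qed.
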